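(* Let $X$ be an infinite compact space. The following assertions are equivalent: (1) $X$ is scattered. (2) Every closed infinite-dimensional vector subspace of $C_p(X)$ contains a copy of $(c_0)_p$ which is complemented in the space $C_p(X)$.
   Context: Compact spaces are Hausdorff. $C_p(X)$ denotes the vector space $C(X)$ of continuous real-valued functions on a Tychonoff space $X$ endowed with the topology of pointwise convergence. $(c_0)_p=\{(x_n)\in\mathbb{R}^{\mathbb{N}}: x_n\to 0\}$ is endowed with the topology inherited from the product $\mathbb{R}^{\mathbb{N}}$. A space is scattered if every non-empty subspace of it has an isolated point. A copy of a topological vector space $G$ in a topological vector space $E$ is a vector subspace of $E$ that is linearly homeomorphic to $G$ (with the subspace topology); it is complemented in $E$ if it is the range of a continuous linear projection $P:E\to E$. *)

(* Defs.v *)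
From HB Require Import structures.
From mathcomp Require Import all_boot all_order all_algebra.
From mathcomp Require Import all_classical all_reals all_analysis.

Set Implicit Arguments.
Unset Strict Implicit.
Unset Printing Implicit Defensive.

Import Order.TTheory GRing.Theory Num.Theory.
Import numFieldNormedType.Exports.

Local Open Scope classical_set_scope.
Local Open Scope ring_scope.

Definition scattered (X : topologicalType) : Prop :=
  forall A : set X, A !=set0 -> isolated A !=set0.

Definition vector_subspace (K : pzRingType) (E : lmodType K) (F : set E) : Prop :=
  submod_closed (mem F).

Definition finite_dimensional (K : pzRingType) (E : lmodType K) (F : set E) : Prop :=
  exists (n : nat) (e : 'I_n -> E),
    F = [set \sum_(i < n) a i *: e i | a in [set: 'I_n -> K]].

(* F, with the topology inherited from E, is linearly homeomorphic to G: S is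
   any extension to E of the inverse of T, and only its restriction to F is
   required to be continuous *)
Definition copy_of (K : numDomainType) (G E : topologicalLmodType K)
    (F : set E) : Prop :=
  vector_subspace F /\
  exists (T : {linear G -> E}) (S : E -> G),
    [/\ range T = F, continuous T, cancel T S & {within F, continuous S}].

Definition complemented (K : numDomainType) (E : topologicalLmodType K)
    (F : set E) : Prop :=
  exists P : {linear E -> E},
    [/\ continuous P, forall x, P (P x) = P x & range P = F].

Section initial_pointwise.
Context {R : realType} {I : topologicalType} {V : lmodType R}.
Variable ev : V -> I -> R.
Local Notation W := (initial_topology (ev : V -> {ptws I -> R})).

Lemma cvg_initial_ptws (F : set_system W) (f : W) : Filter F ->
  (forall i, (fun g : W => ev g i) @ F --> ev f i) -> F --> f.
Proof.
move=> FF Fi; apply: cvg_trans; last exact: cvg_id.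
move=> A /= [_ [[B oB <-]] Bf BA].
have : ((fun g : W => (ev g : {ptws I -> R})) @ F) --> (ev f : {ptws I -> R}).
  apply/pointwise_cvgP => i; exact: Fi.
by move=> /(_ B (open_nbhs_nbhs (conj oB Bf))) FB; exact: (filterS BA FB).
Qed.

Lemma continuous_ev (i : I) : continuous (fun g : W => ev g i).
Proof.
move=> g; apply: (@continuous_comp W {ptws I -> R} R ev (@proj I (fun=> R) i)).
  exact: initial_continuous.
exact: proj_continuous.
Qed.

Lemma initial_ptws_add : (forall f g i, ev (f + g) i = ev f i + ev g i) ->
  continuous (fun x : W * W => ((x.1 : V) + (x.2 : V) : W)).
Proof.
move=> evD [f g]; apply: cvg_initial_ptws => i.
have E : (fun x : W * W => ev ((x.1 : V) + x.2) i) =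
         (fun x : W * W => ev x.1 i + ev x.2 i) by apply/funext => x.
suff : (fun x : W * W => ev x.1 i + ev x.2 i) @ (f, g) --> ev f i + ev g i.
  by rewrite -evD -E.
apply: cvgD.
- apply: (@continuous_comp (W * W)%type W R fst (fun h : W => ev h i) (f, g)).
    exact: cvg_fst.
  exact: continuous_ev.
- apply: (@continuous_comp (W * W)%type W R snd (fun h : W => ev h i) (f, g)).
    exact: cvg_snd.
  exact: continuous_ev.
Qed.

Lemma initial_ptws_scale : (forall a f i, ev (a *: f) i = a * ev f i) ->
  continuous (fun x : R^o * W => (x.1 *: (x.2 : V) : W)).
Proof.
move=> evZ [a f]; apply: cvg_initial_ptws => i.
have E : (fun x : R^o * W => ev (x.1 *: (x.2 : V)) i) =
         (fun x : R^o * W => x.1 * ev x.2 i) by apply/funext => x.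
suff : (fun x : R^o * W => (x.1 : R) * ev x.2 i) @ (a, f) --> a * ev f i.
  by rewrite -evZ -E.
apply: cvgM.
- exact: cvg_fst.
- apply: (@continuous_comp (R^o * W)%type W R snd (fun h : W => ev h i) (a, f)).
    exact: cvg_snd.
  exact: continuous_ev.
Qed.

End initial_pointwise.

(* The library puts no canonical topology on continuousType; this alias carries
   the pointwise operations and the topology inherited from R^X. *)
Definition Cp (R : realType) (X : topologicalType) : Type := continuousType X R.

Section Cp.
Context {R : realType} {X : topologicalType}.
Local Notation Cp := (Cp R X).
Implicit Types f g h : Cp.

HB.instance Definition _ := Choice.on Cp.

Definition Cp_fun f : X -> R := Continuous.sort f.

Lemma Cp_add_subproof f g : continuous (fun x => Cp_fun f x + Cp_fun g x : R).
Proof. by move=> x; apply: cvgD; exact: cts_fun. Qed.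

Lemma Cp_opp_subproof f : continuous (fun x => - Cp_fun f x : R).
Proof. by move=> x; apply: cvgN; exact: cts_fun. Qed.

Lemma Cp_scale_subproof (a : R) f : continuous (fun x => a * Cp_fun f x : R).
Proof. by move=> x; apply: cvgM; [exact: cvg_cst|exact: cts_fun]. Qed.

Definition Cp_zero : Cp := cst (0 : R).
Definition Cp_add f g : Cp := mkcts (@Cp_add_subproof f g).
Definition Cp_opp f : Cp := mkcts (@Cp_opp_subproof f).
Definition Cp_scale (a : R) f : Cp := mkcts (@Cp_scale_subproof a f).

Lemma CpP f g : Cp_fun f =1 Cp_fun g -> f = g.
Proof. by move=> fg; exact/continuousEP. Qed.

Lemma Cp_addA : associative Cp_add.
Proof. by move=> f g h; apply: CpP => x; exact: addrA. Qed.
Lemma Cp_addC : commutative Cp_add.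
Proof. by move=> f g; apply: CpP => x; exact: addrC. Qed.
Lemma Cp_add0 : left_id Cp_zero Cp_add.
Proof. by move=> f; apply: CpP => x; exact: add0r. Qed.
Lemma Cp_addN : left_inverse Cp_zero Cp_opp Cp_add.
Proof. by move=> f; apply: CpP => x; exact: addNr. Qed.

HB.instance Definition _ :=
  GRing.isZmodule.Build Cp Cp_addA Cp_addC Cp_add0 Cp_addN.

Lemma Cp_scaleA a b f : Cp_scale a (Cp_scale b f) = Cp_scale (a * b) f.
Proof. by apply: CpP => x; exact: mulrA. Qed.
Lemma Cp_scale1 : left_id 1 Cp_scale.
Proof. by move=> f; apply: CpP => x; exact: mul1r. Qed.
Lemma Cp_scaleDr : right_distributive Cp_scale +%R.
Proof. by move=> a f g; apply: CpP => x; exact: mulrDr. Qed.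
Lemma Cp_scaleDl f : {morph Cp_scale^~ f : a b / a + b}.
Proof. by move=> a b; apply: CpP => x; exact: mulrDl. Qed.

HB.instance Definition _ := GRing.Zmodule_isLmodule.Build R Cp
  Cp_scaleA Cp_scale1 Cp_scaleDr Cp_scaleDl.

HB.instance Definition _ := Topological.copy Cp
  (initial_topology (Cp_fun : Cp -> {ptws X -> R})).

HB.instance Definition _ :=
  PreTopologicalNmodule_isTopologicalNmodule.Build Cp
    (initial_ptws_add (ev := Cp_fun) (fun _ _ _ => erefl)).
HB.instance Definition _ :=
  TopologicalNmodule_isTopologicalLmodule.Build R Cp
    (initial_ptws_scale (ev := Cp_fun) (fun _ _ _ => erefl)).

Lemma Cp_cvgP (F : set_system Cp) f : Filter F ->
  F --> f <-> forall x, (fun g => Cp_fun g x) @ F --> Cp_fun f x.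
Proof.
move=> FF; split=> [Ff x|]; last exact: (cvg_initial_ptws (ev := Cp_fun)).
by apply: cvg_trans (cvg_app _ Ff) _; exact: (continuous_ev (ev := Cp_fun)).
Qed.

End Cp.

Definition c0_pred (R : realType) : {pred nat -> R^o} :=
  mem [set u : nat -> R^o | u @ \oo --> (0 : R^o)].
Arguments c0_pred : clear implicits.

Record c0p (R : realType) : Type :=
  C0p { c0_seq :> nat -> R^o ; _ : c0_seq \in c0_pred R }.

Section c0p.
Context {R : realType}.

HB.instance Definition _ := [isSub of c0p R for @c0_seq R].
HB.instance Definition _ := [Choice of c0p R by <:].

Lemma c0_submod_closed : submod_closed (c0_pred R).
Proof.
split; first by apply/mem_set; exact: cvg_cst.
move=> a u v /set_mem u0 /set_mem v0; apply/mem_set => /=.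
rewrite -[X in _ --> X](addr0 (0 : R)) -[X in _ --> X + _](mulr0 a).
by apply: cvgD => //; apply: cvgM => //; exact: cvg_cst.
Qed.

HB.instance Definition _ :=
  GRing.isSubmodClosed.Build R (nat -> R^o) (c0_pred R) c0_submod_closed.
HB.instance Definition _ := [SubChoice_isSubLmodule of c0p R by <:].

HB.instance Definition _ := Topological.copy (c0p R)
  (initial_topology (@c0_seq R : c0p R -> {ptws nat -> R})).

HB.instance Definition _ :=
  PreTopologicalNmodule_isTopologicalNmodule.Build (c0p R)
    (initial_ptws_add (ev := @c0_seq R) (fun _ _ _ => erefl)).
HB.instance Definition _ :=
  TopologicalNmodule_isTopologicalLmodule.Build R (c0p R)
    (initial_ptws_scale (ev := @c0_seq R) (fun _ _ _ => erefl)).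

Lemma c0p_cvgP (F : set_system (c0p R)) (u : c0p R) : Filter F ->
  F --> u <-> forall n, (fun v : c0p R => (v n : R)) @ F --> (u n : R).
Proof.
move=> FF; split=> [Fu n|]; last exact: (cvg_initial_ptws (ev := @c0_seq R)).
by apply: cvg_trans (cvg_app _ Fu) _; exact: (continuous_ev (ev := @c0_seq R)).
Qed.

End c0p.

(* Main.v *)
From HB Require Import structures.
Require Import Defs.
From mathcomp Require Import all_boot all_order all_algebra.
From mathcomp Require Import all_classical all_reals all_analysis.
From mathcomp Require Import ring lra zify.
Import Order.TTheory GRing.Theory Num.Theory.
Import numFieldNormedType.Exports.

Set Implicit Arguments.
Unset Strict Implicit.
Unset Printing Implicit Defensive.

Local Open Scope classical_set_scope.
Local Open Scope ring_scope.

(** If X is scattered, the norm of C(X) behaves near a suitable point p like that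
of c0. Call a set of points negligible if every infinite-dimensional subspace of
F contains normalised functions arbitrarily small on it. Negligible sets form an
ideal (negligible_ideal). In a scattered compact space, an ideal that does not
contain the whole space always concentrates at one point p of some neighbourhood
U that is not in it (scattered_ideal); a gliding hump towards p then produces
normalised functions h n in F whose absolute values have bounded sums
(c0_sequence). The same principle shows that countably many functions on X have
countably many common fibres, which makes the h n vanish eventually at each point
of X, and that X is sequentially compact, which makes the peaks y n of the h n
converge, after passing to a subsequence, to some point p. The functionals
f (y n) - f p then tend to 0, and are nearly dual to the h n; once made
biorthogonal (biorthogonal_functionals), they give a continuous projection onto
the copy of c0 spanned by the h n (complemented_copy).

If X is not scattered, there is a continuous map phi from X onto the unit interval
(onto_unit_interval). Pull back the space of continuous functions on the interval
whose second difference on a dyadic interval depends only on its length. This is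
a pointwise closed condition, and the space is infinite-dimensional, since it
contains the iterates of the tent map. In a copy of c0 inside it, the images of
the unit vectors form a point-finite sequence; by Baire's theorem they eventually
all vanish on one dyadic interval of some level k. Their second
differences of level k and below then vanish on every dyadic interval, so they are
piecewise affine with nodes of level k and span a finite-dimensional space, which
is absurd (no_copy). *)

(** * Linear algebra, powers of one half, and continuity *)

Lemma underdetermined (K : fieldType) (m k : nat) (A : 'M[K]_(m, k)) :
  (k < m)%N -> exists2 a : 'rV_m, a != 0 & a *m A = 0.
Proof.
move=> km; have : kermx A != 0.
  rewrite -mxrank_eq0 mxrank_ker -lt0n subn_gt0.
  exact: leq_ltn_trans (rank_leq_col A) km.
by case/rowV0Pn => a /sub_kermxP a0 an0; exists a.
Qed.

Lemma continuous_approx (R : realType) (X : topologicalType) (f : X -> R) :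
  (forall e : R, 0 < e ->
     exists2 g : X -> R, continuous g & forall x, `|f x - g x| <= e) ->
  continuous f.
Proof.
move=> fg x; apply/cvgrPdist_le => e e0.
have e3 : 0 < e / 3 by rewrite divr_gt0.
have [g cg gP] := fg _ e3.
have /cvgrPdist_le/(_ _ e3) := cg x.
apply: filterS => y gxy.
have -> : f x - f y = (f x - g x) + (g x - g y) - (f y - g y) by ring.
apply: le_trans (ler_normB _ _) _.
have := ler_normD (f x - g x) (g x - g y).
have := gP x; have := gP y; lra.
Qed.

Lemma countable_setU (T : Type) (A B : set T) :
  countable A -> countable B -> countable (A `|` B).
Proof.
move=> cA cB; rewrite -bigcup2E; apply: bigcup_countable => // -[//|[//|n] _].
exact: countable0.
Qed.

Lemma linear_of (R : nzRingType) (V W : lmodType R) (f : V -> W) :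
  linear f -> exists T : {linear V -> W}, T = f :> (V -> W).
Proof.
move=> lf.
by exists (HB.pack_for {linear V -> W} f (GRing.isLinear.Build R V W *:%R f lf)).
Qed.

Lemma continuous_sub (R : realType) (T : topologicalType) (f g : T -> R) :
  continuous f -> continuous g -> continuous (fun x => f x - g x).
Proof. by move=> cf cg x; apply: cvgB; [exact: cf|exact: cg]. Qed.

Lemma continuous_lincomb (R : realType) (T : topologicalType) (I : Type)
    (r : seq I) (a : I -> R) (f : I -> T -> R) :
  (forall i, continuous (f i)) -> continuous (fun x => \sum_(i <- r) a i * f i x).
Proof.
move=> cf; elim: r => [|i r IH] x.
  rewrite (_ : (fun=> _) = cst 0); first exact: cvg_cst.
  by apply/funext => y; rewrite big_nil.
rewrite (_ : (fun=> _) = (fun y => a i * f i y + \sum_(i <- r) a i * f i y)).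
  by apply: cvgD; [apply: cvgM; [exact: cvg_cst|exact: cf]|exact: IH].
by apply/funext => y; rewrite big_cons.
Qed.

Lemma closed_eq0 (R : realType) (T : topologicalType) (u : T -> R) : continuous u ->
  closed [set x | u x = 0].
Proof.
move=> /continuous_closedP/(_ [set 0]); apply.
by apply: accessible_closed_set1; apply: hausdorff_accessible; exact: Rhausdorff.
Qed.

(** Iterating a choice function on finite lists: the n-th term may be required to
    satisfy a condition that involves all the earlier ones. *)
Lemma history_choice (E : Type) (P : seq E -> E -> Prop) :
  (forall s, exists e, P s e) ->
  exists u : nat -> E, forall n, P [seq u i | i <- iota 0 n] (u n).
Proof.
move=> /choice [c cP].
pose s := fix s n := if n is m.+1 then rcons (s m) (c (s m)) else [::].
exists (c \o s) => n /=.
suff -> : [seq c (s i) | i <- iota 0 n] = s n by exact: cP.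
elim: n => // n IH.
by rewrite -[n.+1]addn1 iotaD map_cat IH cats1 addn1.
Qed.

Lemma half_pow (R : realType) (n : nat) : (2 : R) ^- n.+1 = 2 ^- n / 2.
Proof. by rewrite exprSr invfM. Qed.

Lemma half_pow_gt0 (R : realType) (n : nat) : 0 < (2 : R) ^- n.
Proof. by rewrite invr_gt0 exprn_gt0. Qed.

Lemma half_pow_small (R : realType) (e : R) :
  0 < e -> exists n, (2 : R) ^- n < e.
Proof.
move=> e0; exists (Num.truncn e^-1).+1.
rewrite invf_plt ?posrE ?exprn_gt0// (lt_le_trans (truncnS_gt _))//.
by rewrite -natrX ler_nat ltnW// ltn_expl.
Qed.

Lemma expr_half_le1 (R : realType) (n : nat) : n%:R * (2 : R) ^- n <= 1.
Proof.
rewrite ler_pdivrMr ?exprn_gt0// mul1r -natrX ler_nat.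
exact/ltnW/ltn_expl.
Qed.

Lemma sum_half_pow (R : realType) (a n : nat) :
  \sum_(a <= i < n) (2 : R) ^- i.+1 <= (2 : R) ^- a.
Proof.
have [na|an] := leqP n a; first by rewrite big_geq// ltW// half_pow_gt0.
suff -> : \sum_(a <= i < n) (2 : R) ^- i.+1 = (2 : R) ^- a - (2 : R) ^- n.
  by rewrite gerBl ltW// half_pow_gt0.
elim: n an => // n IH; rewrite ltnS leq_eqVlt => /predU1P[->|an].
  by rewrite big_nat1 half_pow; lra.
by rewrite big_nat_recr 1?ltnW// half_pow/= IH//; lra.
Qed.

Lemma continuous_Cp_eval (R : realType) (X : topologicalType) (x : X) :
  continuous (fun f : Cp R X => Cp_fun f x).
Proof. exact: (continuous_ev (ev := Cp_fun)). Qed.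

Lemma continuous_c0_coord (R : realType) (n : nat) :
  continuous (fun c : c0p R => (c n : R)).
Proof. exact: (continuous_ev (ev := @c0_seq R)). Qed.

(** * Ideals of sets in a scattered compact space *)

Section Ideals.
Context {X : topologicalType}.

Definition set_ideal (I : set (set X)) :=
  [/\ I set0, forall A B, A `<=` B -> I B -> I A
    & forall A B, I A -> I B -> I (A `|` B)].

(** Otherwise the sets that contain K up to a member of the ideal form a proper
    filter. It has no cluster point in K, since it contains the complement of every
    set of the ideal. *)
Lemma compact_locally_in_ideal (I : set (set X)) (K : set X) :
  set_ideal I -> compact K ->
  (forall x, K x -> exists2 W, nbhs x W & I W) -> I K.
Proof.
move=> [I0 IS IU] cK KI; apply: contrapT => nIK.
pose F : set_system X := [set A | I (K `\` A)].
have FF : ProperFilter F.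
  apply: Build_ProperFilter_ex.
    move=> A FA; apply/set0P/negP => /eqP A0; apply: nIK.
    by move: FA; rewrite A0 /F/= setD0.
  split.
  - by rewrite /F/= setDT.
  - by move=> A B FA FB; rewrite /F/= setDIr; exact: IU.
  - by move=> A B AB; apply: IS; exact: setDS.
have [|x [Kx Fx]] := cK F _.
  by rewrite /F/= setDv.
have [W xW IW] := KI x Kx.
have FCW : F (~` W) by apply: IS IW => z [_ /contrapT].
by have [z []] := Fx _ _ FCW xW.
Qed.

(** The source of all three uses of scatteredness. The points without a
    neighbourhood in I form a nonempty set, by compactness; p is an isolated
    point of it, and U a closed neighbourhood of p that contains no other such
    point. What remains of U off p is then locally in I. *)
Lemma scattered_ideal (I : set (set X)) :
  hausdorff_space X -> compact [set: X] -> scattered X ->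
  set_ideal I -> ~ I setT ->
  exists (p : X) (U : set X), [/\ nbhs p U, ~ I U & forall V, nbhs p V -> I (U `\` V)].
Proof.
move=> hX cX sX idI nIX; have [I0 IS IU] := idI.
pose B := [set x : X | forall W, nbhs x W -> ~ I W].
have [x [Bx]] : isolated B !=set0.
  apply: sX; apply: contrapT => /forallNP B0; apply: nIX.
  apply: compact_locally_in_ideal => // x _.
  by have /existsNP [W /not_implyP[xW /contrapT IW]] := B0 x; exists W.
move=> [V xV VB].
have [U xU UV] := compact_regular hX cX filterT xV.
exists x, (closure U); split.
- by apply: filterS xU; exact: subset_closure.
- by apply: (set_mem Bx); apply: filterS xU; exact: subset_closure.
- move=> W xW.
  have cUW : compact (closure U `\` W°).
    apply: subclosed_compact cX _ => //.
    by apply: closedI; [exact: closed_closure|exact/open_closedC/open_interior].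
  apply: (IS _ (closure U `\` W°)).
    by apply: setDS; exact: interior_subset.
  apply: compact_locally_in_ideal => // y [Uy nWy].
  have nBy : ~ B y.
    move=> By; have : (V `&` B) y by split=> //; exact: UV.
    by rewrite VB => yx; apply: nWy; rewrite yx.
  by have /existsNP [W' /not_implyP[yW' /contrapT IW']] := nBy; exists W'.
Qed.

End Ideals.

(** * Infinite-dimensional subspaces and triangular sequences *)

Section Rich.
Context {R : realType} {X : topologicalType}.
Local Notation Cp := (Cp R X).
Implicit Types (f g h : Cp) (F H : set Cp) (s : seq X) (x y : X).

Lemma subspaceP F :
  vector_subspace F <-> F 0 /\ forall a f g, F f -> F g -> F (a *: f + g).
Proof.
split=> [[/set_mem F0 Flin]|[F0 Flin]].
  by split=> // a f g /mem_set Ff /mem_set Fg; exact/set_mem/Flin.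
split=> [|a f g /set_mem Ff /set_mem Fg]; first exact/mem_set.
exact/mem_set/Flin.
Qed.

Lemma subspace_sum F (I : Type) (r : seq I) (P : pred I) (h : I -> Cp) :
  vector_subspace F -> (forall i, F (h i)) -> F (\sum_(i <- r | P i) h i).
Proof.
move=> /subspaceP[F0 FL] Fh; apply: big_ind => // f g Ff Fg.
by have := FL 1 f g Ff Fg; rewrite scale1r.
Qed.

Lemma subspaceZ F a f : vector_subspace F -> F f -> F (a *: f).
Proof. by move=> /subspaceP[F0 FL] /(FL a f 0)/(_ F0); rewrite addr0. Qed.

Lemma Cp_sumE (I : Type) (r : seq I) (P : pred I) (h : I -> Cp) x :
  Cp_fun (\sum_(i <- r | P i) h i) x = \sum_(i <- r | P i) Cp_fun (h i) x.
Proof. by apply: (big_morph (fun f : Cp => Cp_fun f x)). Qed.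

(** Evaluation at finitely many points is injective on H; the induction splits
    off one point at a time, with at most one more generator each time. *)
Lemma vanishing_finite_dimensional s H : vector_subspace H ->
  (forall h, H h -> (forall x, x \in s -> Cp_fun h x = 0) -> h = 0) ->
  finite_dimensional H.
Proof.
elim: s H => [|x s IH] H sH Hs.
  exists 0%N, (fun=> 0); apply/seteqP; split=> [h Hh|h [a _ <-]].
    by exists (fun=> 0) => //; rewrite big_ord0 (Hs h).
  by rewrite big_ord0; have /subspaceP[] := sH.
have /subspaceP[H0 HL] := sH.
pose H' := [set h | H h /\ Cp_fun h x = 0].
have sH' : vector_subspace H'.
  apply/subspaceP; split=> [|a f g [Hf fx] [Hg gx]]; first by split.
  split; first exact: HL.
  by rewrite [LHS](_ : _ = a * Cp_fun f x + Cp_fun g x)// fx gx mulr0 addr0.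
have [|n [e eH']] := IH _ sH'.
  move=> h [Hh hx] hs; apply: Hs => // z; rewrite inE => /predU1P[->//|].
  exact: hs.
have [Hx0|/existsNP[h1 /not_implyP[Hh1 /eqP hx1]]] :=
    pselect (forall h, H h -> Cp_fun h x = 0).
  exists n, e; rewrite -eH'; apply/seteqP; split=> [h Hh|h []//].
  by split=> //; exact: Hx0.
exists n.+1, (fun i => if unlift ord0 i is Some j then e j else h1).
apply/seteqP; split=> [h Hh|h [a _ <-]].
  pose c := Cp_fun h x / Cp_fun h1 x.
  have : H' (h - c *: h1).
    split; first by rewrite addrC -scaleNr; exact: HL.
    rewrite [LHS](_ : _ = Cp_fun h x - c * Cp_fun h1 x)//.
    by rewrite divfK// subrr.
  rewrite eH' => -[a _ ha].
  exists (fun i => if unlift ord0 i is Some j then a j else c) => //.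
  rewrite big_ord_recl unlift_none.
  under eq_bigr do rewrite liftK.
  by rewrite ha addrC subrK.
rewrite big_ord_recl unlift_none.
under eq_bigr do rewrite liftK.
apply: HL => //.
have : H' (\sum_(i < n) a (lift ord0 i) *: e i).
  by rewrite eH'; exists (fun i => a (lift ord0 i)).
by case.
Qed.

(** For a subspace this is infinite dimension, put in the form in which it is
    used: finitely many vanishing conditions never exhaust H. It passes to the
    subspaces cut out by such conditions without any linear algebra. *)
Definition rich H := vector_subspace H /\
  forall s, exists h, [/\ H h, forall x, x \in s -> Cp_fun h x = 0
                       & exists y, Cp_fun h y != 0].

Lemma infinite_dimensional_rich H :
  vector_subspace H -> ~ finite_dimensional H -> rich H.
Proof.
move=> sH nH; split=> // s; apply: contrapT => /forallNP nh; apply: nH.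
apply: (vanishing_finite_dimensional (s := s)) => // h Hh hs.
apply: CpP => y; apply/eqP/negPn/negP => hy.
by apply: (nh h); split=> //; exists y.
Qed.

Definition peak h y := Cp_fun h y = 1 /\ forall x, `|Cp_fun h x| <= 1.

Lemma attains_norm h (y0 : X) : compact [set: X] ->
  exists y, forall x, `|Cp_fun h x| <= `|Cp_fun h y|.
Proof.
move=> cX.
have [||y _ hy] := @compact_EVT_max X R (fun x => `|Cp_fun h x|) setT _ cX.
- by exists y0.
- apply: continuous_subspaceT => x; apply: cvg_norm; exact: cts_fun.
- by exists y => x; apply: hy; rewrite inE.
Qed.

Lemma peak_rescale h y : (forall x, `|Cp_fun h x| <= `|Cp_fun h y|) ->
  Cp_fun h y != 0 -> peak ((Cp_fun h y)^-1 *: h) y.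
Proof.
move=> hy y0; split=> [|x]; first exact: mulVf.
rewrite [X in `|X|](_ : _ = (Cp_fun h y)^-1 * Cp_fun h x)//.
by rewrite normrM normfV ler_pdivrMl ?normr_gt0// mulr1.
Qed.

Lemma rich_peak H : compact [set: X] -> rich H -> forall s, exists h y,
  [/\ H h, forall x, x \in s -> Cp_fun h x = 0 & peak h y].
Proof.
move=> cX [sH Hs] s; have [h [Hh hs [y0 hy0]]] := Hs s.
have [y hy] := attains_norm h y0 cX.
have y0n : Cp_fun h y != 0.
  by rewrite -normr_gt0 (lt_le_trans _ (hy y0))// normr_gt0.
exists ((Cp_fun h y)^-1 *: h), y; split.
- exact: subspaceZ.
- move=> x /hs hx; rewrite [LHS](_ : _ = (Cp_fun h y)^-1 * Cp_fun h x)//.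
  by rewrite hx mulr0.
- exact: peak_rescale.
Qed.

Lemma rich_vanishing H s : rich H ->
  rich [set h | H h /\ forall x, x \in s -> Cp_fun h x = 0].
Proof.
move=> [/subspaceP[H0 HL] Hs]; split.
  apply/subspaceP; split=> [|a f g [Hf fs] [Hg gs]]; first by split.
  split=> [|x xs]; first exact: HL.
  rewrite [LHS](_ : _ = a * Cp_fun f x + Cp_fun g x)//.
  by rewrite fs// gs// mulr0 addr0.
move=> s'; have [h [Hh hs hy]] := Hs (s ++ s').
by exists h; split=> //; [split=> // x xs|move=> x xs]; apply: hs;
  rewrite mem_cat xs ?orbT.
Qed.

(** The evaluations at the points y n are triangular with unit diagonal on the
    h m, which makes the h m linearly independent in a quantitative way, see
    triangular_coef. *)
Definition triangular (h : nat -> Cp) (y : nat -> X) :=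
  (forall n, Cp_fun (h n) (y n) = 1) /\
  forall m n, (n < m)%N -> Cp_fun (h m) (y n) = 0.

Definition linear_span (h : nat -> Cp) : set Cp :=
  [set f | exists n (a : nat -> R), f = \sum_(0 <= i < n) a i *: h i].

Lemma span_subset (h : nat -> Cp) F :
  vector_subspace F -> (forall n, F (h n)) -> linear_span h `<=` F.
Proof.
by move=> sF Fh _ [n [a ->]]; apply: subspace_sum => // i; exact: subspaceZ.
Qed.

Lemma span_subspace (h : nat -> Cp) : vector_subspace (linear_span h).
Proof.
have ext n m a : (n <= m)%N -> \sum_(0 <= i < n) a i *: h i =
    \sum_(0 <= i < m) (if (i < n)%N then a i else 0) *: h i.
  move=> nm; rewrite [RHS](big_cat_nat (n := n))//= [X in _ = _ + X]big_nat.
  rewrite [X in _ = _ + X]big1 ?addr0; last first.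
    by move=> i /andP[ni _]; rewrite ltnNge ni scale0r.
  by apply: eq_big_nat => i /andP[_ ->].
apply/subspaceP; split.
  by exists 0%N, (fun=> 0); rewrite big_nil.
move=> c f g [n [a ->]] [m [b ->]].
exists (maxn n m), (fun i => c * (if (i < n)%N then a i else 0) +
   (if (i < m)%N then b i else 0)).
rewrite (ext n (maxn n m)) ?leq_maxl// (ext m (maxn n m)) ?leq_maxr//.
rewrite scaler_sumr -big_split/=; apply: eq_bigr => i _.
by rewrite scalerDl scalerA.
Qed.

Lemma triangular_eval (h : nat -> Cp) (y : nat -> X) n (a : nat -> R) i : triangular h y -> (i < n)%N ->
  Cp_fun (\sum_(0 <= j < n) a j *: h j) (y i) =
  \sum_(0 <= j < i) a j * Cp_fun (h j) (y i) + a i.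
Proof.
move=> [h1 h0] ilt; rewrite Cp_sumE (big_cat_nat (n := i.+1))//=.
rewrite [X in _ + X]big_nat [X in _ + X]big1; last first.
  move=> j /andP[ij _].
  by rewrite [LHS](_ : _ = a j * Cp_fun (h j) (y i))// h0// mulr0.
rewrite addr0 big_nat_recr//=; congr (_ + _).
by rewrite [LHS](_ : _ = a i * Cp_fun (h i) (y i))// h1 mulr1.
Qed.

(** Among size s + 1 functions some nontrivial combination vanishes at the points
    of s; evaluating at y i, for the least i with a nonzero coefficient, shows
    that it is not the zero function. *)
Lemma rich_span (h : nat -> Cp) (y : nat -> X) : triangular h y -> rich (linear_span h).
Proof.
move=> tri; split=> [|s]; first exact: span_subspace.
pose A := \matrix_(i < (size s).+1, j < size s)
            Cp_fun (h i) (nth (y 0%N) s j).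
have [a an0 aA] := underdetermined A (ltnSn _).
pose b (i : nat) := a 0 (inord i : 'I_(size s).+1).
exists (\sum_(0 <= i < (size s).+1) b i *: h i); split.
- by exists (size s).+1, b.
- move=> x xs; rewrite Cp_sumE big_mkord.
  have jlt : (index x s < size s)%N by rewrite index_mem.
  move: aA => /rowP/(_ (Ordinal jlt)); rewrite !mxE => aA0.
  rewrite -[RHS]aA0; apply: eq_bigr => i _; rewrite !mxE /= nth_index//.
  by rewrite /b inord_val.
- have : exists i, (i < (size s).+1)%N && (b i != 0).
    have [i ai] : exists i, a 0 i != 0 by apply/rV0Pn.
    by exists i; rewrite /b inord_val ltn_ord.
  move=> exb; case: (ex_minnP exb) => i /andP[ilt bi] imin.
  exists (y i); rewrite (triangular_eval _ tri)// big_nat big1 ?add0r//.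
  move=> j /andP[_ ji]; have [->|bj] := eqVneq (b j) 0; first by rewrite mul0r.
  have := imin j; rewrite bj (ltn_trans ji)//= => /(_ isT).
  by rewrite leqNgt ji.
Qed.

(** Solving the triangular system for the coefficients costs a factor 2 at each
    step. The bound is crude, but it does not depend on n. *)
Lemma triangular_coef (h : nat -> Cp) (y : nat -> X) n (a : nat -> R) (M : R) : triangular h y ->
  (forall i x, `|Cp_fun (h i) x| <= 1) ->
  (forall x, `|Cp_fun (\sum_(0 <= j < n) a j *: h j) x| <= M) ->
  forall i, (i < n)%N -> `|a i| <= 2 ^+ i * M.
Proof.
move=> tri h1 fM.
have M0 : 0 <= M by apply: le_trans (fM (y 0%N)).
have sumS k : \sum_(0 <= j < k) (2 : R) ^+ j * M = (2 ^+ k - 1) * M.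
  elim: k => [|k IH]; first by rewrite big_nil expr0 subrr mul0r.
  by rewrite big_nat_recr//= IH exprS; ring.
move=> i; elim/ltn_ind: i => i IH ilt.
have := triangular_eval a tri ilt => /esym/(canRL (addKr _)) ->.
apply: le_trans (ler_normD _ _) _; rewrite normrN.
have -> : 2 ^+ i * M = \sum_(0 <= j < i) (2 : R) ^+ j * M + M by rewrite sumS; ring.
apply: lerD; last exact: fM.
apply: le_trans (ler_norm_sum _ _ _) _.
apply: ler_sum_nat => j /andP[_ ji]; rewrite normrM -[leRHS]mulr1.
by apply: ler_pM => //; apply: IH => //; exact: ltn_trans ilt.
Qed.

End Rich.

(** * Point-finite sequences equivalent to the basis of c0 *)

Section GlidingHump.
Context {R : realType} {X : topologicalType}.
Hypotheses (hX : hausdorff_space X) (cX : compact [set: X]) (sX : scattered X).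
Local Notation Cp := (Cp R X).
Implicit Types (f g h : Cp) (F H : set Cp) (x y : X).

Lemma nbhs_Cp_near f p (e : R) : 0 < e ->
  nbhs p [set x | `|Cp_fun f p - Cp_fun f x| <= e].
Proof.
move=> e0; have cf : continuous (Cp_fun f) by exact: cts_fun.
by have /cvgrPdist_le/(_ _ e0) := cf p.
Qed.

(** A continuous image of X in the countable product of lines is a scattered
    compact metrizable space, hence countable. The direct proof applies
    scattered_ideal to the sets on which x |-> (g n x) has countably many values:
    off the fibre of p, the neighbourhood U is a countable union of sets U minus V,
    with V a neighbourhood of p given by one g i and one radius. *)
Lemma countably_many_fibres (g : nat -> Cp) (x0 : X) :
  exists d : nat -> X, forall x, exists k, forall n,
    Cp_fun (g n) x = Cp_fun (g n) (d k).
Proof.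
pose G x n := Cp_fun (g n) x.
pose I (A : set X) := (countable (G @` A) : Prop).
have idI : set_ideal I.
  split=> [|A B AB|A B cA cB]; rewrite /I.
  - by rewrite image_set0; exact: countable0.
  - by apply: sub_countable; apply: subset_card_le; exact: image_subset.
  - by rewrite image_setU; exact: countable_setU.
have /countable_injP[c cinj] : countable (G @` [set: X]).
  apply: contrapT => /(scattered_ideal hX cX sX idI) [p [U [pU nU IV]]].
  apply: nU.
  pose W (i : nat * nat) := U `\`
    [set x | `|Cp_fun (g i.1) p - Cp_fun (g i.1) x| <= 2 ^- i.2].
  have cW : countable (\bigcup_i G @` W i).
    apply: bigcup_countable => // i _; apply: IV.
    exact/nbhs_Cp_near/half_pow_gt0.
  have : countable ([set G p] `|` \bigcup_i G @` W i).
    by apply: countable_setU => //; exact: finite_set_countable.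
  apply: sub_countable; apply: subset_card_le => _ [x Ux <-].
  have [->|nGx] := pselect (G x = G p); first by left.
  right.
  have [n gn] : exists n, Cp_fun (g n) p - Cp_fun (g n) x != 0.
    apply: contrapT => /forallNP gn; apply: nGx; apply/funext => n.
    by have /negP/negPn := gn n; rewrite subr_eq0 => /eqP.
  have [m hm] : exists m, (2 : R) ^- m < `|Cp_fun (g n) p - Cp_fun (g n) x|.
    by apply: half_pow_small; rewrite normr_gt0.
  exists (n, m) => //; exists x => //; split=> //=.
  by apply/negP; rewrite -ltNge.
have [k|d dP] := @choice _ _ (fun k y => (exists x, c (G x) = k) -> c (G y) = k).
  by have [[x xk]|nx] := pselect (exists x, c (G x) = k);
    [exists x|exists x0].
exists d => x; exists (c (G x)) => n.
suff : G x = G (d (c (G x))) by move/(congr1 (fun u => u n)).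
apply: cinj; rewrite ?inE; [by exists x|by exists (d (c (G x)))|].
by rewrite dP//; exists x.
Qed.

(** V is negligible when the restriction to V is strictly singular on F: bounded
    below on no infinite-dimensional subspace. *)
Definition negligible F (V : set X) :=
  forall H, rich H -> H `<=` F -> forall e : R, 0 < e ->
  exists h y, [/\ H h, peak h y & forall x, V x -> `|Cp_fun h x| <= e].

(** Stability under union is the point. If A is negligible, a triangular
    sequence with |h i| <= e 2^-(i+1) 2^-i on A spans a rich subspace whose
    elements are all small on A, by triangular_coef; inside it, an element small
    on B is found. *)
Lemma negligible_ideal F : set_ideal (negligible F).
Proof.
split.
- move=> H rH _ e _; have [h [y [Hh _ py]]] := rich_peak cX rH [::].
  by exists h, y.
- move=> A B AB nB H rH HF e e0; have [h [y [Hh py hB]]] := nB H rH HF e e0.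
  by exists h, y; split=> // x /AB; exact: hB.
move=> A B nA nB H rH HF e e0.
pose P (s : seq (Cp * X)) (u : Cp * X) := [/\ H u.1,
  forall x, x \in map snd s -> Cp_fun u.1 x = 0, peak u.1 u.2 &
  forall x, A x ->
    `|Cp_fun u.1 x| <= e * (2 : R) ^- (size s).+1 * (2 : R) ^- size s].
have [s|u uP] := @history_choice _ P.
  have e1 : 0 < e * (2 : R) ^- (size s).+1 * (2 : R) ^- size s.
    by rewrite !mulr_gt0// half_pow_gt0.
  have [|h [y [[Hh hs] py hA]]] := nA _ (rich_vanishing (map snd s) rH) _ _ e1.
    by move=> h [/HF].
  by exists (h, y).
pose h n := (u n).1; pose y n := (u n).2.
have tri : triangular h y.
  split=> [n|m n nm]; first by have [_ _ []] := uP n.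
  have [_ + _ _] := uP m; apply; apply/mapP; exists (u n) => //.
  by apply/mapP; exists n; rewrite // mem_iota.
have h1 i x : `|Cp_fun (h i) x| <= 1 by have [_ _ [_ + _]] := uP i; exact.
have hA i x : A x -> `|Cp_fun (h i) x| <= e * (2 : R) ^- i.+1 * (2 : R) ^- i.
  by have [_ _ _] := uP i; rewrite size_map size_iota; exact.
have spanH : linear_span h `<=` H.
  by apply: span_subset; [exact: rH.1|move=> n; have [] := uP n].
have [f [z [sf pf fB]]] := nB _ (rich_span tri) (subset_trans spanH HF) e e0.
exists f, z; split=> //; first exact: spanH.
move=> x [Ax|]; last exact: fB.
case: sf pf fB => n [a ->] [_ a1] _.
have ale := triangular_coef tri h1 a1.
rewrite Cp_sumE; apply: le_trans (ler_norm_sum _ _ _) _.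
apply: (@le_trans _ _ (\sum_(0 <= i < n) e * (2 : R) ^- i.+1)).
  apply: ler_sum_nat => i /andP[_ ilt].
  rewrite [X in `|X|](_ : _ = a i * Cp_fun (h i) x)// normrM.
  apply: le_trans (ler_pM _ _ (ale i ilt) (hA i x Ax)) _ => //.
  by rewrite mulr1 mulrCA mulfV ?mulr1// expf_neq0.
rewrite -mulr_sumr ger_pMr// (le_trans (sum_half_pow _ _ _))//.
by rewrite expr0 invr1.
Qed.

Lemma nbhs_history (s : seq (Cp * X)) p (e : R) : 0 < e ->
  nbhs p [set x | forall u, u \in s -> `|Cp_fun u.1 p - Cp_fun u.1 x| <= e].
Proof.
move=> e0; elim: s => [|u s IH].
  by apply: filterS filterT => x _ u.
apply: filterS (filterI (nbhs_Cp_near u.1 p e0) IH) => x [xu xs] v.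
by rewrite inE => /predU1P[->//|]; exact: xs.
Qed.

Lemma not_negligible_setT F : rich F -> ~ negligible F setT.
Proof.
move=> rF /(_ F rF (@subset_refl _ _) (2^-1)).
case=> [//|h [y [_ [hy _] /(_ y I)]]].
by rewrite hy normr1; lra.
Qed.

(** Since X is not negligible, scattered_ideal yields p and U such that, on some
    rich H, the norm is controlled up to a factor e by the values on U, while U off
    any neighbourhood of p is negligible. A gliding hump towards p gives
    peaks h n in H vanishing at p that are small outside V n, where V n is a
    neighbourhood of p on which the earlier peaks are small. On U the sum of the
    |h i| is then at most 3. With signs chosen at a point x of X, the
    sum at x is the value at x of an element of H bounded by 3 on U, hence by 3 / e
    on X. Vanishing
    at d 0, ..., d (n - 1) makes the sequence point-finite. *)
Theorem c0_sequence F (d : nat -> X) :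
  (forall x, exists k, forall f, F f -> Cp_fun f x = Cp_fun f (d k)) ->
  rich F ->
  exists (h : nat -> Cp) (y : nat -> X) (C : R),
  [/\ forall n, F (h n) /\ peak (h n) (y n),
      forall x, exists N, forall n, (N <= n)%N -> Cp_fun (h n) x = 0
    & forall x n, \sum_(0 <= i < n) `|Cp_fun (h i) x| <= C].
Proof.
move=> dF rF.
have [p [U [pU nU UV]]] := scattered_ideal hX cX sX (negligible_ideal F)
  (not_negligible_setT rF).
have [H [rH HF [e e0 HU]]] : exists H, [/\ rich H, H `<=` F &
    exists2 e : R, 0 < e & forall h y, H h -> peak h y ->
      exists2 x, U x & e < `|Cp_fun h x|].
  apply: contrapT => nn; apply: nU => H rH HF e e0.
  apply: contrapT => nh; apply: nn; exists H; split=> //; exists e => // h y Hh ph.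
  apply: contrapT => nx; apply: nh; exists h, y; split=> // x Ux.
  by rewrite leNgt; apply/negP => ex; apply: nx; exists x.
have HUb h (c : R) : H h -> (forall x, U x -> `|Cp_fun h x| <= c) ->
    forall x, `|Cp_fun h x| <= c / e.
  move=> Hh hc x; have [y hy] := attains_norm h x cX.
  apply: le_trans (hy x) _.
  have c0 : 0 <= c by apply: le_trans (hc p (nbhs_singleton pU)).
  have [->|hy0] := eqVneq (Cp_fun h y) 0.
    by rewrite normr0 divr_ge0// ltW.
  have [|z Uz] := HU _ _ _ (peak_rescale hy hy0).
    by apply: subspaceZ => //; exact: rH.1.
  rewrite [X in `|X|](_ : _ = (Cp_fun h y)^-1 * Cp_fun h z)//.
  rewrite normrM normfV ltr_pdivlMl ?normr_gt0// => ez.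
  by rewrite ler_pdivlMr//; apply/ltW/(lt_le_trans ez)/hc.
pose V (s : seq (Cp * X)) := [set x | forall u, u \in s ->
  `|Cp_fun u.1 p - Cp_fun u.1 x| <= (2 : R) ^- size s].
pose P (s : seq (Cp * X)) (u : Cp * X) := [/\ H u.1,
  Cp_fun u.1 p = 0, forall i, (i < size s)%N -> Cp_fun u.1 (d i) = 0,
  peak u.1 u.2 &
  forall x, U x -> ~ V s x -> `|Cp_fun u.1 x| <= (2 : R) ^- (size s).+1].
have [s|u uP] := @history_choice _ P.
  have := UV _ (nbhs_history s p (half_pow_gt0 R (size s))).
  have rH' := rich_vanishing (p :: [seq d i | i <- iota 0 (size s)]) rH.
  move=> /(_ _ rH' _ _ (half_pow_gt0 R (size s).+1)).
  case=> [h [/HF]//|h [y [[Hh hs] py hV]]].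
  exists (h, y); split=> //=.
  - by apply: hs; rewrite inE eqxx.
  - move=> i ilt; apply: hs; rewrite inE; apply/orP; right.
    by apply/mapP; exists i; rewrite // mem_iota.
  - by move=> x Ux Vx; exact: hV.
pose h n := (u n).1.
(* The n-th step adds at most 1 if x is in V n, where the previous sum is at most 1,
   and at most 2^-(n+1) otherwise. *)
have hU x n : U x -> \sum_(0 <= i < n) `|Cp_fun (h i) x| <= 3 - (2 : R) ^- n.
  move=> Ux; elim: n => [|n IH].
    by rewrite big_nil expr0 invr1; lra.
  rewrite big_nat_recr//=.
  have [hp hx] : (forall i, Cp_fun (h i) p = 0) /\ `|Cp_fun (h n) x| <= 1.
    by split=> [i|]; [have [] := uP i|have [_ _ _ [_ +] _] := uP n; exact].
  have hn0 := half_pow_gt0 R n; have := half_pow R n.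
  have [Vx|nVx] := pselect (V [seq u i | i <- iota 0 n] x).
    have : \sum_(0 <= i < n) `|Cp_fun (h i) x| <= n%:R * (2 : R) ^- n.
      rewrite -[n in n%:R]subn0 mulr_natl -sumr_const_nat.
      apply: ler_sum_nat => i /andP[_ ilt].
      have := Vx (u i); rewrite size_map size_iota.
      rewrite -/(h i) hp sub0r normrN; apply.
      by apply/mapP; exists i; rewrite // mem_iota.
    have := expr_half_le1 R n.
    have : (2 : R) ^- n <= 1 by rewrite invf_le1 ?exprn_gt0// exprn_ege1//; lra.
    lra.
  have [_ _ _ _ /(_ x Ux nVx)] := uP n.
  by rewrite size_map size_iota -/(h n); lra.
exists h, (fun n => (u n).2), (3 / e); split.
- by move=> n; have [/HF] := uP n.
- move=> x; have [k dk] := dF x; exists k.+1 => n kn.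
  rewrite dk; last by have [/HF] := uP n.
  by have [_ _ + _ _] := uP n; rewrite size_map size_iota; exact.
- move=> x n.
  (* signs chosen at x, used at all points of U *)
  pose f : Cp := \sum_(0 <= i < n) Num.sg (Cp_fun (h i) x) *: h i.
  have Hf : H f.
    apply: subspace_sum => [|i]; first exact: rH.1.
    by apply: subspaceZ; [exact: rH.1|have [] := uP i].
  have -> : \sum_(0 <= i < n) `|Cp_fun (h i) x| = Cp_fun f x.
    by rewrite Cp_sumE; apply: eq_bigr => i _; rewrite normrEsg.
  apply: le_trans (ler_norm _) _; apply: HUb => // z Uz.
  rewrite Cp_sumE; apply: le_trans (ler_norm_sum _ _ _) _.
  apply: (@le_trans _ _ (\sum_(0 <= i < n) `|Cp_fun (h i) z|)).
    apply: ler_sum => i _.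
    rewrite [X in `|X|](_ : _ = Num.sg (Cp_fun (h i) x) * Cp_fun (h i) z)//.
    by rewrite normrM ler_piMl// normr_sg lern1 leq_b1.
  by apply: le_trans (hU z n Uz) _; rewrite gerBl ltW// half_pow_gt0.
Qed.

End GlidingHump.

(** * Complemented copies from biorthogonal systems *)

Section ComplementedCopy.
Context {R : realType} {X : topologicalType}.
Local Notation Cp := (Cp R X).
Implicit Types (f g : Cp) (F : set Cp) (x p : X).

(** The copy is the range of T c = sum of c n h n, and T composed with
    f |-> (nu n f) is the projection. Point-finiteness makes T continuous for the
    pointwise topologies, since each value of T c is a finite sum; the bound C
    makes the sums converge uniformly, so that T c is continuous on X. *)
Lemma complemented_copy F (h : nat -> Cp) (nu : nat -> Cp -> R) (C : R) :
  closed F -> vector_subspace F -> (forall n, F (h n)) ->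
  (forall x, exists N, forall n, (N <= n)%N -> Cp_fun (h n) x = 0) ->
  (forall x n, \sum_(0 <= i < n) `|Cp_fun (h i) x| <= C) ->
  (forall n a f g, nu n (a *: f + g) = a * nu n f + nu n g) ->
  (forall n, continuous (nu n)) ->
  (forall n m, nu n (h m) = (n == m)%:R) ->
  (forall f, nu ^~ f @ \oo --> (0 : R)) ->
  exists G : set Cp, [/\ G `<=` F, copy_of (c0p R) G & complemented G].
Proof.
move=> clF sF Fh hfin hC nuL nuc nuh nu0.
(* N x is the number of terms that matter at x, so no limit has to be taken. *)
have [N hN] := choice hfin.
pose part (c : nat -> R) n : Cp := \sum_(0 <= i < n) c i *: h i.
have partE c n x : Cp_fun (part c n) x = \sum_(0 <= i < n) c i * Cp_fun (h i) x.
  by rewrite Cp_sumE.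
pose Tf (c : nat -> R) x := Cp_fun (part c (N x)) x.
have TfE c n x : (N x <= n)%N -> Cp_fun (part c n) x = Tf c x.
  move=> Nn; rewrite /Tf !partE (big_cat_nat (n := N x))//=.
  rewrite [X in _ + X]big_nat [X in _ + X]big1 ?addr0// => i /andP[Ni _].
  by rewrite hN// mulr0.
have Tc (c : c0p R) : continuous (Tf c).
  apply: continuous_approx => e e0.
  have C1 x : 0 < C + 1.
    by have := hC x 0%N; rewrite big_nil; lra.
  have [X0|/existsNP[x0 _]] := pselect (forall x : X, False).
    by exists (Tf c) => x; have := X0 x.
  have e1 : 0 < e / (C + 1) by rewrite divr_gt0// C1.
  have [M _ cM] : \forall n \near \oo, `|0 - c n : R| <= e / (C + 1).
    have c0 : (c : nat -> R) @ \oo --> (0 : R) by case: (c) => u cu; exact: (set_mem cu).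
    by move/cvgrPdist_le: c0; apply.
  exists (Cp_fun (part c M)); first exact: cts_fun.
  move=> x; rewrite -(TfE c (maxn (N x) M)) ?leq_maxl// !partE.
  rewrite (big_cat_nat (n := M)) ?leq_maxr//= addrAC subrr add0r.
  apply: le_trans (ler_norm_sum _ _ _) _.
  apply: (@le_trans _ _
      (\sum_(M <= i < maxn (N x) M) (e / (C + 1)) * `|Cp_fun (h i) x|)).
    apply: ler_sum_nat => i /andP[Mi _]; rewrite normrM ler_wpM2r//.
    by have := cM i Mi; rewrite sub0r normrN.
  rewrite -mulr_sumr mulrAC ler_pdivrMr ?C1// ler_pM2l//.
  apply: le_trans (_ : C <= C + 1); last by rewrite lerDl.
  apply: le_trans (hC x (maxn (N x) M)).
  by rewrite [leRHS](big_cat_nat (n := M)) ?leq_maxr//= lerDr sumr_ge0.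
pose T (c : c0p R) : Cp := mkcts (Tc c).
have Tlin : linear T.
  move=> a c d; apply: CpP => x.
  rewrite [LHS](_ : _ = Tf (a *: c + d) x)//.
  rewrite [RHS](_ : _ = a * Tf c x + Tf d x)//.
  rewrite /Tf !partE mulr_sumr -big_split/=; apply: eq_bigr => i _.
  by rewrite [X in X * _](_ : _ = a * c i + d i)// mulrDl mulrA.
have [T' T'E] := linear_of Tlin.
have Sc0 f : (nu ^~ f : nat -> R^o) \in c0_pred R by apply/mem_set; exact: nu0.
pose S f : c0p R := C0p (Sc0 f).
have Slin a f g : S (a *: f + g) = a *: S f + S g.
  by apply: val_inj; apply/funext => n /=; exact: nuL.
have nu_sum n c m : nu n (part c m) = \sum_(0 <= i < m) c i * (n == i)%:R.
  have nu0' : nu n 0 = 0.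
    by have := nuL n (-1) 0 0; rewrite scaler0 addr0 mulN1r addNr.
  elim: m => [|m IH]; first by rewrite /part !big_nil.
  by rewrite /part !big_nat_recr//= addrC nuL nuh -IH addrC.
have TS f : Tf (nu ^~ f) = Cp_fun (T (S f)) by [].
have part_cvg (c : c0p R) : part c @ \oo --> T c.
  apply/Cp_cvgP => x; apply: cvg_near_cst; exists (N x) => // n /= Nn.
  exact: TfE.
have FT c : F (T c).
  apply: (@closed_cvg _ _ \oo _ (part c) F clF _ (T c) (part_cvg c)).
  apply: nearW => n.
  by apply: subspace_sum => // i; exact: subspaceZ.
have STK : cancel T S.
  move=> c; apply: val_inj; apply/funext => n /=.
  have : nu n \o part c @ \oo --> nu n (T c).
    by apply: continuous_cvg; [exact: nuc|exact: part_cvg].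
  have : nu n \o part c @ \oo --> (c n : R).
    apply: cvg_near_cst; exists n.+1 => // m /= nm.
    rewrite nu_sum (bigD1_seq n) ?iota_uniq ?mem_index_iota//=.
    rewrite eqxx mulr1 big1 ?addr0// => i /negbTE; rewrite eq_sym => ->.
    by rewrite mulr0.
  by move=> cB cA; exact: (cvg_unique (@Rhausdorff R) cA cB).
have cT : continuous T.
  move=> c; apply/(@Cp_cvgP _ _ (T @ c) (T c) (fmap_filter _ (nbhs_filter c))) => x.
  have : continuous (fun d : c0p R => Cp_fun (T d) x).
    rewrite (_ : (fun=> _) = (fun d : c0p R =>
      \sum_(0 <= i < N x) Cp_fun (h i) x * d i)); last first.
      apply/funext => d; rewrite [LHS](_ : _ = Tf d x)// /Tf partE.
      by apply: eq_bigr => i _; rewrite mulrC.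
    by apply: continuous_lincomb => i; exact: continuous_c0_coord.
  exact.
have cS : continuous S.
  move=> f; apply/(@c0p_cvgP _ (S @ f) (S f) (fmap_filter _ (nbhs_filter f))) => n.
  exact: nuc.
exists (range T); split.
- by move=> _ [c _ <-].
- split.
    apply/subspaceP; split.
      by exists 0 => //; rewrite -T'E linear0.
    move=> a _ _ [c _ <-] [d _ <-]; exists (a *: c + d) => //; exact: Tlin.
  exists T', S; rewrite T'E; split => //.
  exact: continuous_subspaceT.
- have Plin : linear (T \o S) by move=> a f g /=; rewrite Slin Tlin.
  have [P PE] := linear_of Plin.
  exists P; rewrite PE; split.
  + by move=> f; apply: continuous_comp; [exact: cS|exact: cT].
  + by move=> f /=; rewrite STK.
  + apply/seteqP; split=> [_ [f _ <-]|_ [c _ <-]]; first by exists (S f).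
    by exists (T c) => //=; rewrite STK.
Qed.

End ComplementedCopy.

(** * Biorthogonal functionals in a scattered space *)

Section Biorthogonal.
Context {R : realType} {X : topologicalType}.
Hypotheses (hX : hausdorff_space X) (cX : compact [set: X]) (sX : scattered X).
Local Notation Cp := (Cp R X).
Implicit Types (f g : Cp) (F : set Cp) (x p : X).

(** Scattered compact spaces are sequentially compact: here the ideal consists of
    the sets that y visits finitely often, and J is the set of visits to U. *)
Lemma convergent_subsequence (y : nat -> X) :
  exists (p : X) (J : set nat), (forall N, exists2 n, (N <= n)%N & J n) /\
    forall V, nbhs p V -> exists N, forall n, (N <= n)%N -> J n -> V (y n).
Proof.
pose I (A : set X) := exists N, forall n, (N <= n)%N -> ~ A (y n).
have idI : set_ideal I.
  split=> [|A B AB [N NB]|A B [N NA] [M MB]]; first by exists 0%N => n _ [].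

    by exists N => n /NB nB /AB /nB.
  exists (maxn N M) => n; rewrite geq_max => /andP[/NA nA /MB nB].
  by case.
have nIT : ~ I setT by move=> [N /(_ N (leqnn _))]; apply; exact: Logic.I.
have [p [U [pU nU UV]]] := scattered_ideal hX cX sX idI nIT.
exists p, [set n | U (y n)]; split.
  move=> N; apply: contrapT => nN; apply: nU; exists N => n Nn Un.
  by apply: nN; exists n.
move=> V /UV [N NV]; exists N => n Nn Un.
by apply: contrapT => nV; apply: (NV n Nn).
Qed.

(** Along J all the conditions on a new index hold eventually, because the values
    at p of the chosen h i are 0. The square of 2^-n leaves room for a sum of n
    terms. *)
Lemma convergent_block (h : nat -> Cp) (y : nat -> X) :
  (forall n, Cp_fun (h n) (y n) = 1) ->
  (forall x, exists N, forall n, (N <= n)%N -> Cp_fun (h n) x = 0) ->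
  exists (p : X) (s : nat -> nat),
  [/\ {homo s : m n / (m < n)%N},
      forall n, Cp_fun (h (s n)) p = 0,
      forall n m, (n < m)%N -> Cp_fun (h (s m)) (y (s n)) = 0,
      forall n m, (m < n)%N -> `|Cp_fun (h (s m)) (y (s n))| <=
                     (2 : R) ^- n * (2 : R) ^- n
    & forall V, nbhs p V -> exists N, forall n, (N <= n)%N -> V (y (s n))].
Proof.
move=> h1 hfin; have [p [J [Jinf Jp]]] := convergent_subsequence y.
pose P (t : seq nat) k := [/\ J k, Cp_fun (h k) p = 0,
  forall i, i \in t -> (i < k)%N,
  forall i, i \in t -> Cp_fun (h k) (y i) = 0 &
  forall i, i \in t -> `|Cp_fun (h i) p - Cp_fun (h i) (y k)|
     <= (2 : R) ^- size t * (2 : R) ^- size t].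
have [t|s sP] := @history_choice _ P.
  pose e : R := (2 : R) ^- size t * (2 : R) ^- size t.
  have e0 : 0 < e by rewrite mulr_gt0// half_pow_gt0.
  have [N0 hN0] := hfin p.
  have [M tM] : exists M, forall k, (M <= k)%N -> J k -> forall i, i \in t ->
      [/\ (i < k)%N, Cp_fun (h k) (y i) = 0 &
         `|Cp_fun (h i) p - Cp_fun (h i) (y k)| <= e].
    elim: (t) => [|j t' [M IH]]; first by exists 0%N.
    have [N1 hN1] := hfin (y j).
    have [N2 hN2] := Jp _ (nbhs_Cp_near (h j) p e0).
    exists (maxn (maxn M j.+1) (maxn N1 N2)) => k.
    rewrite !geq_max => /andP[/andP[Mk jk] /andP[N1k N2k]] Jk i.
    rewrite inE => /predU1P[->|it]; last exact: IH.
    by split=> //; [exact: hN1|exact: hN2].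
  have [k] := Jinf (maxn N0 M); rewrite geq_max => /andP[N0k Mk] Jk.
  by exists k; split=> // [|i it|i it|i it]; [exact: hN0|..];
    have [] := tM k Mk Jk i it.
have sin n m : (n < m)%N -> s n \in [seq s i | i <- iota 0 m].
  by move=> nm; apply/mapP; exists n; rewrite // mem_iota.
have sp n : Cp_fun (h (s n)) p = 0 by have [] := sP n.
have shomo : {homo s : m n / (m < n)%N}.
  by move=> m n mn; have [_ _ + _ _] := sP n; apply; exact: sin.
exists p, s; split=> //.
- by move=> n m nm; have [_ _ _ + _] := sP m; apply; exact: sin.
- move=> n m mn; have [_ _ _ _ /(_ (s m) (sin _ _ mn))] := sP n.
  by rewrite sp sub0r normrN size_map size_iota.
- move=> V /Jp[N NV]; exists N => n Nn; apply: NV; last by have [] := sP n.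
  apply: leq_trans Nn _; elim: n => // n IH.
  by apply: leq_ltn_trans IH _; exact: shomo.
Qed.

(** The functionals f |-> f (y n) - f p tend to 0 and have a unit lower
    triangular matrix on the h m. Inverting it by forward substitution gives
    nu n. The entries below the diagonal are so small that the corrections have
    norm at most n 2^-n 2^-n 4 <= 4 2^-n; hence the nu n stay bounded by 4 and
    tend to 0 as well. *)
Lemma biorthogonal_functionals (h : nat -> Cp) (y : nat -> X) p :
  (forall n, Cp_fun (h n) (y n) = 1) ->
  (forall n, Cp_fun (h n) p = 0) ->
  (forall n m, (n < m)%N -> Cp_fun (h m) (y n) = 0) ->
  (forall n m, (m < n)%N -> `|Cp_fun (h m) (y n)| <=
     (2 : R) ^- n * (2 : R) ^- n) ->
  (forall V, nbhs p V -> exists N, forall n, (N <= n)%N -> V (y n)) ->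
  exists nu : nat -> Cp -> R,
  [/\ forall n a f g, nu n (a *: f + g) = a * nu n f + nu n g,
      forall n, continuous (nu n),
      forall n m, nu n (h m) = (n == m)%:R &
      forall f, nu ^~ f @ \oo --> (0 : R)].
Proof.
move=> h1 hp hlow hup yp.
pose P (s : seq (Cp -> R)) (e : Cp -> R) := forall f,
  e f = Cp_fun f (y (size s)) - Cp_fun f p -
    \sum_(0 <= m < size s) Cp_fun (h m) (y (size s)) * nth (fun=> 0) s m f.
have [s|nu nuP] := @history_choice _ P.
  by exists (fun f => Cp_fun f (y (size s)) - Cp_fun f p -
    \sum_(0 <= m < size s) Cp_fun (h m) (y (size s)) * nth (fun=> 0) s m f).
have nuE n f : nu n f = Cp_fun f (y n) - Cp_fun f p -
    \sum_(0 <= m < n) Cp_fun (h m) (y n) * nu m f.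
  rewrite nuP size_map size_iota; congr (_ - _).
  apply: eq_big_nat => m /andP[_ mn].
  by rewrite (nth_map 0%N) ?size_iota// nth_iota// add0n.
have nu_bnd f (M : R) : (forall x, `|Cp_fun f x| <= M) ->
    forall n, `|nu n f| <= 4 * M /\
      `|nu n f - (Cp_fun f (y n) - Cp_fun f p)| <= (2 : R) ^- n * (4 * M).
  move=> fM; have M0 : 0 <= M := le_trans (normr_ge0 _) (fM p).
  elim/ltn_ind => n IH.
  have sum_le : `|\sum_(0 <= m < n) Cp_fun (h m) (y n) * nu m f| <=
      (2 : R) ^- n * (4 * M).
    apply: le_trans (ler_norm_sum _ _ _) _.
    apply: (@le_trans _ _
        (\sum_(0 <= m < n) (2 : R) ^- n * (2 : R) ^- n * (4 * M))).
      apply: ler_sum_nat => m /andP[_ mn]; rewrite normrM.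
      by apply: ler_pM => //; [exact: hup|case: (IH m mn)].
    rewrite sumr_const_nat subn0 -[_ *+ n]mulr_natl [leLHS]mulrA.
    rewrite ler_wpM2r ?mulr_ge0// mulrA -[leRHS]mul1r ler_wpM2r// ?expr_half_le1//.
  split; last by rewrite nuE addrAC subrr add0r normrN.
  have fxy : `|Cp_fun f (y n) - Cp_fun f p| <= 2 * M.
    apply: le_trans (ler_normB _ _) _.
    by have := fM (y n); have := fM p; lra.
  rewrite nuE; case: n {IH} sum_le fxy => [|n] sum_le fxy.
    by rewrite big_nil subr0; lra.
  apply: le_trans (ler_normB _ _) _.
  suff : (2 : R) ^- n.+1 * (4 * M) <= 2 * M by lra.
  have : (2 : R) ^- n <= 1 by rewrite invf_le1 ?exprn_gt0// exprn_ege1//; lra.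
  by rewrite half_pow; nra.
exists nu; split.
- elim/ltn_ind => n IH a f g; rewrite (nuE n f) (nuE n g) nuE.
  rewrite [Cp_fun (a *: f + g) (y n)](_ : _ =
    a * Cp_fun f (y n) + Cp_fun g (y n))//.
  rewrite [Cp_fun (a *: f + g) p](_ : _ = a * Cp_fun f p + Cp_fun g p)//.
  have -> : \sum_(0 <= m < n) Cp_fun (h m) (y n) * nu m (a *: f + g) =
     a * \sum_(0 <= m < n) Cp_fun (h m) (y n) * nu m f +
      \sum_(0 <= m < n) Cp_fun (h m) (y n) * nu m g.
    rewrite mulr_sumr -big_split/=; apply: eq_big_nat => m /andP[_ mn].
    by rewrite IH//; ring.
  by ring.
- elim/ltn_ind => n IH.
  pose nu' m := if (m < n)%N then nu m else fun=> 0.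
  rewrite (_ : nu n = (fun f => Cp_fun f (y n) - Cp_fun f p -
    \sum_(0 <= m < n) Cp_fun (h m) (y n) * nu' m f)); last first.
    apply/funext => f; rewrite nuE; congr (_ - _).
    by apply: eq_big_nat => m /andP[_ mn]; rewrite /nu' mn.
  apply: continuous_sub; first by apply: continuous_sub; exact: continuous_Cp_eval.
  apply: continuous_lincomb => m; rewrite /nu'; case: ifP => [|_].
    exact: IH.
  exact: cst_continuous.
- elim/ltn_ind => n IH m; rewrite nuE hp subr0.
  have -> : \sum_(0 <= k < n) Cp_fun (h k) (y n) * nu k (h m) =
      \sum_(0 <= k < n | k == m) Cp_fun (h k) (y n).
    rewrite [RHS]big_mkcond; apply: eq_big_nat => k /andP[_ kn].
    by rewrite IH//; case: eqP => _; rewrite ?mulr1 ?mulr0.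
  have [mn|nm|->] := ltngtP m n.
  + by rewrite big_nat1_eq mn subrr.
  + by rewrite big_nat1_eq (leq_gtF (ltnW nm)) subr0 hlow.
  + by rewrite big_nat1_eq ltnn subr0 h1.
- move=> f; have [z fz] := attains_norm f p cX.
  pose M := `|Cp_fun f z|.
  have nub n := (nu_bnd f M fz n).2.
  apply/cvgrPdist_le => e e0.
  have M0 : 0 <= M by exact: normr_ge0.
  have M1 : 0 < 4 * M + 1 by lra.
  have e1 : 0 < e / 2 / (4 * M + 1) by rewrite !divr_gt0.
  have [k ke] := half_pow_small e1.
  have e2 : 0 < e / 2 by rewrite divr_gt0.
  have [N hN] := yp _ (nbhs_Cp_near f p e2).
  exists (maxn k N) => // n /=; rewrite geq_max => /andP[kn /hN /= fyn].
  rewrite sub0r normrN.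
  have -> : nu n f = (nu n f - (Cp_fun f (y n) - Cp_fun f p)) -
     (Cp_fun f p - Cp_fun f (y n)) by ring.
  apply: le_trans (ler_normB _ _) _.
  suff : (2 : R) ^- n * (4 * M) <= e / 2 by have := nub n; lra.
  have : (2 : R) ^- n <= (2 : R) ^- k.
    by rewrite lef_pV2 ?posrE ?exprn_gt0// ler_weXn2l//; lra.
  move: ke; rewrite ltr_pdivlMr// => ke nk; have := half_pow_gt0 R n; nra.
Qed.

(** A triangular sequence in F spans a subspace with countably many fibres, to
    which c0_sequence applies; convergent_block and biorthogonal_functionals
    provide the coordinate functionals on a subsequence. *)
Theorem scattered_complemented_copy F :
  closed F -> vector_subspace F -> ~ finite_dimensional F ->
  exists G : set Cp, [/\ G `<=` F, copy_of (c0p R) G & complemented G].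
Proof.
move=> clF sF nF.
have rF := infinite_dimensional_rich sF nF.
have [h0 [y0 [Fh0 hy0]]] : exists (h : nat -> Cp) (y : nat -> X),
    (forall n, F (h n)) /\ triangular h y.
  pose P (s : seq (Cp * X)) (u : Cp * X) := [/\ F u.1,
    forall x, x \in map snd s -> Cp_fun u.1 x = 0 & peak u.1 u.2].
  have [s|u uP] := @history_choice _ P.
    have [h [y hy]] := rich_peak cX rF (map snd s).
    by exists (h, y).
  exists (fun n => (u n).1), (fun n => (u n).2); split=> [n|].
    by have [] := uP n.
  split=> [n|m n nm]; first by have [_ _ []] := uP n.
  have [_ + _] := uP m; apply; apply/mapP; exists (u n) => //.
  by apply/mapP; exists n; rewrite // mem_iota.
have [d hd] := countably_many_fibres hX cX sX h0 (y0 0%N).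
have spanF : linear_span h0 `<=` F by exact: span_subset.
have [|h [y [C [hF hfin hC]]]] := c0_sequence hX cX sX _ (rich_span hy0) (d := d).
  move=> x; have [k hk] := hd x; exists k => _ [n [a ->]].
  rewrite !Cp_sumE; apply: eq_bigr => i _.
  by rewrite [LHS](_ : _ = a i * Cp_fun (h0 i) x)// hk.
have [|p [s [shomo hp hlow hup yp]]] := convergent_block _ hfin (y := y).
  by move=> n; have [_ []] := hF n.
have h1 n : Cp_fun (h (s n)) (y (s n)) = 1 by have [_ []] := hF (s n).
have [nu [nuL nuc nuh nu0]] :=
  @biorthogonal_functionals (h \o s) (y \o s) p h1 hp hlow hup yp.
have sge n : (n <= s n)%N.
  by elim: n => // n IH; apply: leq_ltn_trans IH _; exact: shomo.
apply: (complemented_copy clF sF _ _ _ nuL nuc nuh nu0) => [n|x|].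
- by apply: spanF; have [] := hF (s n).
- have [N hN] := hfin x; exists N => n Nn /=; apply: hN.
  exact: leq_trans Nn (sge n).
- move=> x n; apply: le_trans (hC x (s n)).
  elim: n => [|n IH]; first by rewrite big_nil sumr_ge0.
  rewrite big_nat_recr//= [leRHS](big_cat_nat (n := (s n).+1)) ?shomo//=.
  rewrite big_nat_recr//= -[leLHS]addr0; apply: lerD; last by rewrite sumr_ge0.
  by rewrite lerD2r.
Qed.

End Biorthogonal.

(** * Mapping a non-scattered space onto the unit interval *)

Section OntoInterval.
Context {R : realType} {X : topologicalType}.
Hypotheses (hX : hausdorff_space X) (cX : compact [set: X]).

Lemma split_perfect (A U : set X) : isolated A = set0 ->
  open U -> A `&` U !=set0 ->
  exists V : bool -> set X,
    [/\ forall b, open (V b) /\ A `&` V b !=set0,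
        forall b, closure (V b) `<=` U
      & closure (V true) `&` closure (V false) = set0].
Proof.
move=> A0 oU [a [Aa Ua]].
have [b [Ab Ub ba]] : exists b, [/\ A b, U b & b != a].
  apply: contrapT => /forallNP nb.
  suff : isolated A a by rewrite A0.
  split; first exact/mem_set.
  exists U; first exact: open_nbhs_nbhs.
  apply/seteqP; split=> [z [Uz Az]|_ ->//].
  by apply: contrapT => /eqP za; apply: (nb z).
have := hX; rewrite open_hausdorff => /(_ _ _ ba)[[B B'] /= [/set_mem Bb /set_mem B'a]].
move=> [oB oB' /eqP BB'].
have shrink (x : X) (C : set X) : A x -> C x -> U x -> open C ->
    exists V, [/\ open V, A `&` V !=set0 & closure V `<=` C `&` U].
  move=> Ax Cx Ux oC.
  have xCU : nbhs x (C `&` U) by apply: open_nbhs_nbhs; split=> //; exact: openI.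
  have [V xV VCU] := compact_regular hX cX filterT xCU.
  exists V°; split; first exact: open_interior.
    by exists x.
  by apply: subset_trans VCU; apply: closureS; exact: interior_subset.
have [V [oV AV VB]] := shrink b B Ab Bb Ub oB.
have [V' [oV' AV' VB']] := shrink a B' Aa B'a Ua oB'.
exists (fun i => if i then V else V'); split.
- by case.
- by case; [apply: subset_trans VB _|apply: subset_trans VB' _]; exact: subIsetr.
- rewrite -subset0 => z [/VB[Bz _] /VB'[B'z _]].
  by have : (B `&` B') z by []; rewrite BB'.
Qed.

(** The sets W s, indexed by binary words with the last digit first, form a
    Cantor scheme of open sets that meet A. A Urysohn function u n reads the n-th
    digit on the sets of level n + 1, and phi sums the u n as binary digits. The
    range of phi is compact and comes within 2^-k of every t, as the first k
    digits of t can be read off at some point of W s. *)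
Lemma onto_unit_interval (A : set X) : A !=set0 -> isolated A = set0 ->
  exists phi : X -> R, [/\ continuous phi, forall x, 0 <= phi x <= 1
    & forall t : R, 0 <= t <= 1 -> exists x, phi x = t].
Proof.
move=> [a0 Aa0] A0.
pose good U := open U /\ A `&` U !=set0.
have [U|step stepP] := @choice (set X) (bool -> set X) (fun U V => good U ->
    [/\ forall b, good (V b), forall b, closure (V b) `<=` U
      & closure (V true) `&` closure (V false) = set0]).
  have [[oU AU]|nU] := pselect (good U); last by exists (fun=> U).
  by have [V VP] := split_perfect A0 oU AU; exists V.
pose W := fix W (s : seq bool) := if s is b :: s' then step (W s') b else setT.
have Wgood s : good (W s).
  elim: s => [|b s IH]; last by have [+ _ _] := stepP _ IH; apply.
  by split; [exact: openT|exists a0].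
have WS b s : closure (W (b :: s)) `<=` W s.
  by have [_ + _] := stepP _ (Wgood s); apply.
have Wdisj s t : size s = size t -> s <> t ->
    closure (W s) `&` closure (W t) = set0.
  elim: s t => [|b s IH] [|c t]//= [st] bsct.
  have [sEt|sNt] := eqVneq s t.
    rewrite -sEt; have bc : b <> c by move=> bc; apply: bsct; rewrite bc sEt.
    have [_ _ bE] := stepP _ (Wgood s).
    by case: b c bc {bsct} => -[]// _; rewrite setIC.
  rewrite -subset0 -(IH t st (elimN eqP sNt)) => z [zs zt].
  by split; apply: subset_closure; [exact: (WS b)|exact: (WS c)].
pose C n b := \bigcup_(s in [set: n.-tuple bool]) closure (W (b :: s)).
have Ccl n b : closed (C n b).
  by apply: closed_bigcup => [|s _]; [exact: finite_finset|exact: closed_closure].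
have Csep n : uniform_separator (C n false) (C n true).
  apply/(@normal_separatorP R X).1 => //; first exact: compact_normal.
  rewrite -subset0 => z [[s _ sz] [t _ tz]].
  have <- := @Wdisj (false :: s) (true :: t) _ _; first by split.
    by rewrite /= !size_tuple.
  by case.
pose u n : X -> R := Urysohn (C n false) (C n true).
have uW b s x : W (b :: s) x -> u (size s) x = b%:R.
  move=> Wx; have Cx : C (size s) b x.
    by exists (in_tuple s) => //; exact: subset_closure.
  case: b Wx Cx => Wx Cx.
    by apply: (Urysohn_sub1 (Csep (size s))); exists x.
  by apply: (Urysohn_sub0 (Csep (size s))); exists x.
have u01 n x : 0 <= u n x <= 1.
  by have := @Urysohn_range _ R (C n false) (C n true) _ (ex_intro2 _ _ x Logic.I erefl);
    rewrite /= in_itv.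
pose S n x := \sum_(0 <= i < n) (2 : R) ^- i.+1 * u i x.
have uS i x : 0 <= (2 : R) ^- i.+1 * u i x <= (2 : R) ^- i.+1.
  have /andP[u0 u1] := u01 i x; have h0 := half_pow_gt0 R i.+1.
  by rewrite mulr_ge0 ?ler_piMr// ltW.
have Sle m n x : (m <= n)%N -> S m x <= S n x.
  move=> mn; rewrite /S [leRHS](big_cat_nat (n := m))//= lerDl.
  by apply: sumr_ge0 => i _; have /andP[] := uS i x.
have Sub m n x : S n x <= S m x + (2 : R) ^- m.
  have [nm|mn] := leqP n m.
    by apply: le_trans (Sle _ _ x nm) _; rewrite lerDl ltW// half_pow_gt0.
  rewrite /S [leLHS](big_cat_nat (leq0n m) (ltnW mn))/= lerD2l.
  apply: le_trans (sum_half_pow R m n).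
  by apply: ler_sum => i _; have /andP[] := uS i x.
(* the sum of the series, as the supremum of its partial sums *)
pose phi x := sup (range (S ^~ x)).
have phiS m x : S m x <= phi x <= S m x + (2 : R) ^- m.
  have ubS : ubound (range (S ^~ x)) (S m x + (2 : R) ^- m).
    by move=> _ [n _ <-]; exact: Sub.
  apply/andP; split.
    by apply: ub_le_sup; [exists (S m x + (2 : R) ^- m)|exists m].
  by apply: ge_sup => //; exists (S 0%N x), 0%N.
have phic : continuous phi.
  apply: continuous_approx => e e0; have [m me] := half_pow_small e0.
  exists (S m).
    by apply: continuous_lincomb => i; exact: Urysohn_continuous.
  move=> x; have /andP[pl pu] := phiS m x.
  by rewrite ger0_norm ?subr_ge0// lerBlDl (le_trans pu)// lerD2l ltW.
exists phi; split=> //.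
  move=> x; have /andP[] := phiS 0%N x.
  by rewrite /S big_nil expr0 invr1 add0r => -> ->.
pose val := fix val (s : seq bool) : R :=
  if s is b :: s' then val s' + b%:R * (2 : R) ^- (size s').+1 else 0.
have Wval s x : W s x -> S (size s) x = val s.
  elim: s => [|b s IH] Wx; first by rewrite /S big_nil.
  rewrite [LHS]big_nat_recr//= (uW b)// mulrC -IH//.
  by apply: (WS b); exact: subset_closure.
move=> t /andP[t0 t1].
have digits k : exists s, size s = k /\ val s <= t <= val s + (2 : R) ^- k.
  elim: k => [|k [s [sk /andP[sl su]]]].
    by exists [::]; rewrite /= expr0 invr1 add0r t0 t1.
  have [tl|tg] := ltP t (val s + (2 : R) ^- k.+1).
    exists (false :: s); split; first by rewrite /= sk.
    by rewrite /= mul0r addr0 sl ltW.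
  exists (true :: s); split; first by rewrite /= sk.
  rewrite /= mul1r sk tg -addrA (le_trans su)// lerD2l.
  by have := half_pow R k; lra.
have cl : closed (range phi).
  apply: compact_closed; first exact: Rhausdorff.
  by apply: continuous_compact => //; exact: continuous_subspaceT.
suff /cl[x _ xt] : closure (range phi) t by exists x.
move=> B /nbhs_ballP[e /= e0 eB].
have [k ke] := half_pow_small e0.
have [s [sk /andP[sl su]]] := digits k.
have [x [_ Wx]] := (Wgood s).2.
exists (phi x); split; first by exists x.
apply: eB; rewrite /ball /=.
have := Wval s x Wx; rewrite sk => Sv; have /andP[pl pu] := phiS k x.
by rewrite (le_lt_trans _ ke)// ler_norml; apply/andP; split; lra.
Qed.

End OntoInterval.

(** * Functions bent alike at every dyadic level *)

Section DyadicDifferences.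
Context {R : realType}.
Implicit Types (u v : R -> R) (n m j : nat) (t : R).

Definition dyadic n j : R := j%:R * (2 : R) ^- n.

Lemma dyadicS n j : dyadic n j.+1 = dyadic n j + (2 : R) ^- n.
Proof. by rewrite /dyadic -natr1 mulrDl mul1r. Qed.

Lemma dyadic_double n j : dyadic n.+1 j.*2 = dyadic n j.
Proof. by rewrite /dyadic half_pow -muln2 natrM; lra. Qed.

Lemma dyadic_odd n j :
  dyadic n.+1 j.*2.+1 = (dyadic n j + dyadic n j.+1) / 2.
Proof.
by rewrite /dyadic half_pow -addn1 -muln2 -[j.+1]addn1 !natrD natrM; lra.
Qed.

Lemma dyadic01 n j : (j <= 2 ^ n)%N -> 0 <= dyadic n j <= 1.
Proof.
move=> jn; rewrite /dyadic mulr_ge0 ?invr_ge0 ?exprn_ge0//=.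
by rewrite ler_pdivrMr ?exprn_gt0// mul1r -natrX ler_nat.
Qed.

(** The coefficient of u on the Schauder function of the j-th dyadic interval of
    level n. *)
Definition bend u n j : R :=
  u (dyadic n.+1 j.*2.+1) - (u (dyadic n j) + u (dyadic n j.+1)) / 2.

(** The continuous solutions on the unit interval form the Takagi class, up to
    affine functions. On any dyadic interval u determines all the coefficients
    from some level on. *)
Definition level_bent u := forall n j, (j < 2 ^ n)%N -> bend u n j = bend u n 0.

Lemma bend_lincomb (I : Type) (r : seq I) (c : I -> R) (u : I -> R -> R) n j :
  bend (fun t => \sum_(i <- r) c i * u i t) n j =
  \sum_(i <- r) c i * bend (u i) n j.
Proof.
elim: r => [|i r IH]; rewrite /bend.
  by rewrite !big_nil addr0 mul0r subr0.
by rewrite !big_cons -IH /bend; ring.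
Qed.

Lemma eq_bend u v n j : (forall t, 0 <= t <= 1 -> u t = v t) -> (j < 2 ^ n)%N ->
  bend u n j = bend v n j.
Proof.
move=> uv jn; rewrite /bend !uv//; apply: dyadic01; rewrite ?expnS; lia.
Qed.

Definition tent t : R := 1 - `|2 * t - 1|.

Lemma tent_low n j : (j <= 2 ^ n)%N -> tent (dyadic n.+1 j) = dyadic n j.
Proof.
move=> /dyadic01 /andP[d0 d1]; rewrite /tent.
have -> : 2 * dyadic n.+1 j = dyadic n j by rewrite /dyadic half_pow; lra.
by rewrite ler0_norm; lra.
Qed.

Lemma tent_high n j : (2 ^ n <= j <= 2 ^ n.+1)%N ->
  tent (dyadic n.+1 j) = dyadic n (2 ^ n.+1 - j).
Proof.
move=> /andP[j1 j2]; rewrite /tent.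
have -> : 2 * dyadic n.+1 j = dyadic n j by rewrite /dyadic half_pow; lra.
have -> : dyadic n (2 ^ n.+1 - j) = 2 - dyadic n j.
  by rewrite /dyadic natrB// mulrBl expnS natrM natrX mulfK// expf_neq0.
rewrite ger0_norm ?subr_ge0; first lra.
by rewrite /dyadic ler_pdivlMr ?exprn_gt0// mul1r -natrX ler_nat.
Qed.

Lemma bend_tent_low u n j : (j < 2 ^ n)%N ->
  bend (u \o tent) n.+1 j = bend u n j.
Proof.
move=> jn; by rewrite /bend /= !tent_low// ?expnS; lia.
Qed.

Lemma bend_tent_high u n j : (2 ^ n <= j < 2 ^ n.+1)%N ->
  bend (u \o tent) n.+1 j = bend u n (2 ^ n.+1 - j.+1).
Proof.
move=> /andP[j1 j2]; have e2 : (2 ^ n.+2 = (2 ^ n.+1).*2)%N by rewrite expnS mul2n.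
rewrite /bend /= !tent_high ?e2 ?j1 ?j2 ?(ltnW j2) ?(leqW j1)//; last first.
  by apply/andP; split; move: j1 j2; rewrite expnS; lia.
have -> : ((2 ^ n.+1).*2 - j.*2.+1 = (2 ^ n.+1 - j.+1).*2.+1)%N by lia.
have -> : (2 ^ n.+1 - j = (2 ^ n.+1 - j.+1).+1)%N by lia.
by rewrite [X in _ - X / 2]addrC.
Qed.

(** The tent map sends each dyadic interval of level n + 1 affinely onto one of
    level n, so composing with it shifts the levels by one. *)
Lemma level_bent_tent u : level_bent u -> level_bent (u \o tent).
Proof.
move=> hu [|n] j; first by rewrite expn0 ltnS leqn0 => /eqP->.
move=> jn; rewrite [RHS]bend_tent_low ?expn_gt0//.
have [jl|jh] := ltnP j (2 ^ n); first by rewrite bend_tent_low// hu.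
rewrite bend_tent_high ?jh// hu//.
by move: jn jh; rewrite expnS; lia.
Qed.

Lemma bend_id n j : bend id n j = 0.
Proof. by rewrite /bend dyadic_odd subrr. Qed.

Lemma level_bent_tents k : level_bent (iter k tent).
Proof.
elim: k => [|k IH]; first by move=> n j _; rewrite !bend_id.
rewrite (_ : iter k.+1 tent = iter k tent \o tent); first exact: level_bent_tent.
by apply/funext => t; rewrite iterSr.
Qed.

(** The iterated tent maps form a dual basis to the coefficients, which makes the
    space infinite-dimensional. *)
Lemma bend_tents k m : bend (iter k.+1 tent) m 0 = (k == m)%:R.
Proof.
have iterE i : iter i.+1 tent = iter i tent \o tent.
  by apply/funext => t; rewrite iterSr.
elim: m k => [|m IH] k; last first.
  rewrite iterE bend_tent_low ?expn_gt0//.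
  by case: k => [|k]; [exact: bend_id|exact: IH].
have tent0 i : iter i tent (0 : R) = 0.
  elim: i => // i IH; rewrite iterSr (_ : tent 0 = 0)//.
  by rewrite /tent mulr0 sub0r normrN normr1 subrr.
have tent1 : tent 1 = 0 by rewrite /tent mulr1 (_ : 2 - 1 = 1 :> R)// ?normr1; lra.
rewrite /bend /dyadic expr0 invr1 !mulr1 expr1 mul1r.
rewrite !iterSr (_ : tent 2^-1 = 1); last first.
  by rewrite /tent mulfV ?pnatr_eq0// subrr normr0 subr0.
have -> : tent 0%:R = 0 by exact: (tent0 1%N).
rewrite tent1 !tent0 addr0 mul0r subr0.
by case: k => [//|k]; rewrite iterSr tent1 tent0.
Qed.

End DyadicDifferences.

Section BentFunctions.
Context {R : realType} {X : topologicalType}.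
Hypotheses (cX : compact [set: X]).
Variables (phi : X -> R) (pre : R -> X).
Hypotheses (phic : continuous phi) (phi01 : forall x, 0 <= phi x <= 1)
  (preK : forall t : R, 0 <= t <= 1 -> phi (pre t) = t).
Local Notation Cp := (Cp R X).
Implicit Types (f g : Cp) (x : X) (t : R).

(** The pullbacks by phi of the level-bent functions, defined by conditions on
    finitely many values at a time so that the space is pointwise closed; pre
    selects a point in each fibre. *)
Definition bent_functions : set Cp := [set f |
  (forall x y, phi x = phi y -> Cp_fun f x = Cp_fun f y) /\
  level_bent (Cp_fun f \o pre)].

Lemma bent_eval f x t : bent_functions f -> phi x = t -> Cp_fun f (pre t) = Cp_fun f x.
Proof. by move=> [fib _] <-; apply: fib; exact: preK. Qed.

Lemma Cp_bend_lincomb (I : Type) (r : seq I) (c : I -> R) (h : I -> Cp) n j :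
  bend (Cp_fun (\sum_(i <- r) c i *: h i) \o pre) n j =
  \sum_(i <- r) c i * bend (Cp_fun (h i) \o pre) n j.
Proof.
rewrite -bend_lincomb; congr bend; apply/funext => t /=.
by rewrite Cp_sumE.
Qed.

Lemma bent_functions_subspace : vector_subspace bent_functions.
Proof.
apply/subspaceP; split=> [|a f g [ff fl] [gf gl]].
  by split.
have E x : Cp_fun (a *: f + g) x = a * Cp_fun f x + Cp_fun g x by [].
split=> [x y xy|n j jn]; first by rewrite !E (ff _ _ xy) (gf _ _ xy).
have B i : bend (Cp_fun (a *: f + g) \o pre) n i =
    a * bend (Cp_fun f \o pre) n i + bend (Cp_fun g \o pre) n i.
  by rewrite /bend /comp !E; ring.
by rewrite !B fl// gl.
Qed.

Lemma bent_functions_closed : closed bent_functions.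
Proof.
have ce x : continuous (fun f : Cp => Cp_fun f x) by exact: continuous_Cp_eval.
have cb n j : continuous (fun f : Cp => bend (Cp_fun f \o pre) n j).
  rewrite (_ : (fun=> _) = (fun f : Cp => Cp_fun f (pre (dyadic n.+1 j.*2.+1)) -
   \sum_(i <- [:: dyadic n j; dyadic n j.+1]) 2^-1 * Cp_fun f (pre i))).
    by apply: continuous_sub => //; apply: continuous_lincomb.
  by apply/funext => f; rewrite /bend !big_cons big_nil /=; lra.
rewrite (_ : bent_functions =
  \bigcap_(xy in [set xy : X * X | phi xy.1 = phi xy.2])
     [set f : Cp | Cp_fun f xy.1 - Cp_fun f xy.2 = 0] `&`
  \bigcap_(nj in [set nj : nat * nat | (nj.2 < 2 ^ nj.1)%N])
     [set f : Cp | bend (Cp_fun f \o pre) nj.1 nj.2 -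
        bend (Cp_fun f \o pre) nj.1 0 = 0]).
  apply: closedI; apply: closed_bigI => -[a b] _; apply: closed_eq0;
    exact: continuous_sub.
apply/seteqP; split=> f.
  move=> [ff fl]; split=> [[x y] /= xy|[n j] /= nj].
    by rewrite (ff _ _ xy) subrr.
  by rewrite fl// subrr.
move=> [ff fl]; split=> [x y xy|n j nj]; apply/eqP; rewrite -subr_eq0; apply/eqP.
  exact: (ff (x, y)).
exact: (fl (n, j)).
Qed.

Lemma bent_functions_infinite : ~ finite_dimensional bent_functions.
Proof.
move=> [n [e eE]].
have tc : continuous (tent : R -> R).
  move=> t; apply: cvgB; first exact: cvg_cst.
  apply: cvg_norm; apply: cvgB; last exact: cvg_cst.
  by apply: cvgM; [exact: cvg_cst|exact: cvg_id].
have ic k : continuous (iter k (@tent R) \o phi).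
  move=> x; apply: continuous_comp; first exact: phic.
  elim: k (phi x) => [|k IH] t; first exact: cvg_id.
  exact: (@continuous_comp _ _ _ (iter k tent) tent t (IH t) (tc _)).
pose f k : Cp := mkcts (ic k.+1).
have fE k t : 0 <= t <= 1 -> (Cp_fun (f k) \o pre) t = iter k.+1 tent t.
  by move=> t01; rewrite /= -[in RHS](preK t01).
have Ff k : bent_functions (f k).
  split=> [x y xy|m j mj].
    by change (iter k.+1 tent (phi x) = iter k.+1 tent (phi y)); rewrite xy.
  rewrite !(eq_bend (fE k)) ?expn_gt0//; exact: level_bent_tents.
have /choice[A Af] : forall k, exists a : 'I_n -> R, f k = \sum_(i < n) a i *: e i.
  by move=> k; have := Ff k; rewrite eE => -[a _ <-]; exists a.
have [c cn0 cA] := underdetermined (\matrix_(k < n.+1, i < n) A k i) (ltnSn n).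
have f0 : \sum_(k < n.+1) c 0 k *: f k = 0.
  under eq_bigr do rewrite Af scaler_sumr.
  rewrite exchange_big/= big1// => i _.
  under eq_bigr do rewrite scalerA.
  rewrite -scaler_suml; move/rowP: cA => /(_ i); rewrite !mxE.
  by under eq_bigr do rewrite mxE; move=> ->; rewrite scale0r.
move/negP: cn0; apply; apply/eqP/rowP => m; rewrite mxE.
have := Cp_bend_lincomb (index_enum 'I_n.+1) (fun k => c 0 k) (fun k => f k) m 0.
rewrite f0 (bigD1 m)//= big1 ?addr0; last first.
  move=> k /negbTE km; rewrite (eq_bend (fE k)) ?expn_gt0// bend_tents.
  by rewrite -val_eqE /= in km; rewrite km mulr0.
rewrite (eq_bend (fE m)) ?expn_gt0// bend_tents eqxx mulr1 => <-.
by rewrite /bend /= addr0 mul0r subr0.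
Qed.

End BentFunctions.

(** * A subspace without copies of c0 *)

Section NoCopy.
Context {R : realType} {X : topologicalType}.
Hypotheses (cX : compact [set: X]).
Variables (phi : X -> R) (pre : R -> X).
Hypotheses (phic : continuous phi) (phi01 : forall x, 0 <= phi x <= 1)
  (preK : forall t : R, 0 <= t <= 1 -> phi (pre t) = t).
Local Notation Cp := (Cp R X).
Local Notation BF := (bent_functions phi pre).
Implicit Types (f g : Cp) (x : X) (t : R).

Lemma c0_unit_subproof (n : nat) :
  (fun k => (k == n)%:R : R^o) \in c0_pred R.
Proof.
apply/mem_set; apply: cvg_near_cst; exists n.+1 => // k /= nk.
by rewrite gtn_eqF.
Qed.

Definition c0_unit n : c0p R := C0p (c0_unit_subproof n).

(** Otherwise the unit vectors, rescaled to have value 1 at x wherever possible,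
    still tend to 0 coordinatewise. *)
Lemma point_finite (T : {linear c0p R -> Cp}) : continuous T ->
  forall x, exists N, forall n, (N <= n)%N -> Cp_fun (T (c0_unit n)) x = 0.
Proof.
move=> cT x.
pose v n : c0p R := (Cp_fun (T (c0_unit n)) x)^-1 *: c0_unit n.
have v0 : v @ \oo --> (0 : c0p R).
  apply/c0p_cvgP => m; apply: cvg_near_cst; exists m.+1 => // n /= mn.
  rewrite [LHS](_ : _ = (Cp_fun (T (c0_unit n)) x)^-1 * (m == n)%:R)//.
  by rewrite ltn_eqF// mulr0.
have cTx : continuous (fun c => Cp_fun (T c) x).
  move=> c; apply: (@continuous_comp _ _ _ T (fun f : Cp => Cp_fun f x)).
    exact: cT.
  exact: continuous_Cp_eval.
have : (fun n => Cp_fun (T (v n)) x) @ \oo --> Cp_fun (T 0) x.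
  exact: (continuous_cvg _ (cTx 0) v0).
rewrite linear0 => /cvgrPdist_le/(_ (2^-1)) [|N _ hN]; first by rewrite invr_gt0.
exists N => n /hN /=; rewrite linearZ.
rewrite [X in _ - X](_ : _ = (Cp_fun (T (c0_unit n)) x)^-1 *
  Cp_fun (T (c0_unit n)) x)//.
rewrite sub0r normrN.
have [//|nz] := eqVneq (Cp_fun (T (c0_unit n)) x) 0.
by rewrite mulVf// normr1; lra.
Qed.

Lemma closed_image (K : set X) : closed K -> closed (phi @` K).
Proof.
move=> clK; apply: compact_closed; first exact: Rhausdorff.
apply: continuous_compact; first exact: continuous_subspaceT.
exact: subclosed_compact clK cX _.
Qed.

Lemma dyadic_approx k t : 0 <= t < 1 ->
  exists j, (j < 2 ^ k)%N /\ dyadic k j <= t <= dyadic k j.+1.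
Proof.
move=> /andP[t0 t1]; exists (Num.truncn (t * 2 ^+ k)).
have p0 : 0 < (2 : R) ^+ k by rewrite exprn_gt0.
have tk : 0 <= t * 2 ^+ k by rewrite mulr_ge0// ltW.
have := truncn_itv tk; set j := Num.truncn _ => /andP[jt tj].
split.
  rewrite -(ltr_nat R) natrX (le_lt_trans jt)// gtr_pMl//.
by rewrite /dyadic ler_pdivrMr// ler_pdivlMr// jt ltW.
Qed.

(** Baire's theorem for the images under phi of the closed sets of common zeros
    of the tails of the sequence. *)
Lemma vanish_on_interval (f : nat -> Cp) :
  (forall x, exists N, forall n, (N <= n)%N -> Cp_fun (f n) x = 0) ->
  exists N k j, (j < 2 ^ k)%N /\
    forall t, dyadic k j <= t <= dyadic k j.+1 ->
    exists2 x, phi x = t & forall n, (N <= n)%N -> Cp_fun (f n) x = 0.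
Proof.
move=> ffin.
pose K N : set X := \bigcap_(n in [set n | (N <= n)%N]) [set x | Cp_fun (f n) x = 0].
have clK N : closed (K N).
  by apply: closed_bigI => n _; apply: closed_eq0; exact: cts_fun.
pose U N : set R := ~` (phi @` K N).
have [N nd] : exists N, ~ dense (U N).
  apply: contrapT => /forallNP nd.
  have /Baire : forall N, open (U N : set R^o) /\ dense (U N : set R^o).
    move=> N; split; last exact: contrapT (nd N).
    exact/closed_openC/closed_image.
  have : (`]0, 1[%classic : set R^o) !=set0.
    by exists 2^-1; rewrite /= in_itv/=; apply/andP; split; lra.
  move=> ne /(_ _ ne) [|t []] /=; first exact: interval_open.
  rewrite in_itv/= => /andP[t0 t1] tU.
  have [N hN] := ffin (pre t).
  apply: (tU N Logic.I); exists (pre t); first by move=> n /= /hN.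
  by apply: preK; rewrite !ltW.
have [Q [[t0 [oQ Qt0]] QU]] := denseNE nd.
have OK t : Q t -> exists2 x, K N x & phi x = t.
  move=> Qt; apply: contrapT => nK.
  by have : (Q `&` U N) t by []; rewrite QU.
have /nbhs_ballP[r /= r0 rQ] : nbhs (t0 : R) Q by apply: open_nbhs_nbhs.
have t01 : 0 <= t0 < 1.
  have [x _ xt] := OK _ Qt0.
  have := phi01 x; rewrite xt => /andP[-> _] /=.
  have [|y _ yE] := OK (t0 + r / 2).
    by apply: rQ; rewrite /ball /= opprD addrA subrr sub0r normrN gtr0_norm; lra.
  by have := phi01 y; rewrite yE; lra.
have [k kr] := half_pow_small r0.
have [j [jk /andP[jt tj]]] := dyadic_approx k t01.
exists N, k, j; split=> // t /andP[jt' t'j].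
have [|x Kx xt] := OK t.
  apply: rQ; rewrite /ball /=.
  move: jt tj jt' t'j; rewrite dyadicS => *.
  by rewrite ltr_norml; apply/andP; split; lra.
by exists x => // n Nn; exact: Kx.
Qed.

(** Let f n be the images of the unit vectors. From some N on, they vanish over
    one dyadic interval of level k, so their coefficients vanish from level k on
    and they are determined by their values at the 2^k + 1 points of level k.
    Hence 2^k + 2 of them are linearly dependent, against injectivity. *)
Lemma no_copy (G : set Cp) : G `<=` BF -> ~ copy_of (c0p R) G.
Proof.
move=> GBF [_ [T [S [TG cT TK _]]]].
have FT c : BF (T c) by apply: GBF; rewrite -TG; exists c.
pose f n := T (c0_unit n).
have [N [k [j [jk Hj]]]] := vanish_on_interval (point_finite cT).
have bend0 n m i : (N <= n)%N -> (i < 2 ^ (m + k))%N ->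
    bend (Cp_fun (f n) \o pre) (m + k) i = 0.
  move=> Nn ilt.
  have jm : (j * 2 ^ m < 2 ^ (m + k))%N.
    by rewrite expnD mulnC ltn_pmul2l// expn_gt0.
  have [_ lv] := FT (c0_unit n).
  rewrite (lv _ _ ilt) -(lv _ _ jm).
  have van t : dyadic k j <= t <= dyadic k j.+1 -> Cp_fun (f n) (pre t) = 0.
    by move=> /Hj[x xt /(_ n Nn) fx]; rewrite (bent_eval phi01 preK (FT _) xt).
  have e0 : dyadic (m + k) (j * 2 ^ m) = dyadic k j :> R.
    rewrite /dyadic natrM natrX exprD invfM mulrA mulfK// expf_neq0//.
  have h0 : (2 : R) ^- (m + k) <= (2 : R) ^- k.
    by rewrite lef_pV2 ?posrE ?exprn_gt0// ler_weXn2l ?leq_addl//; lra.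
  have e1 : dyadic k j <= (dyadic (m + k) (j * 2 ^ m).+1 : R) <= dyadic k j.+1.
    have := half_pow_gt0 R (m + k); rewrite !dyadicS e0 => hp.
    by apply/andP; split; lra.
  have e2 : dyadic k j <= (dyadic k j : R) <= dyadic k j.+1.
    by move: e1 => /andP[? ?]; apply/andP; split; lra.
  rewrite /bend /= dyadic_odd e0 !van//; first by lra.
  by move: e1 => /andP[? ?]; apply/andP; split; lra.
pose M := (2 ^ k).+2.
have [a an0 aA] := underdetermined (\matrix_(l < M, i < (2 ^ k).+1)
  Cp_fun (f (N + l)%N) (pre (dyadic k i))) (ltnSn _).
pose w : c0p R := \sum_(l < M) a 0 l *: c0_unit (N + l)%N.
have TwE : T w = \sum_(l < M) a 0 l *: f (N + l)%N.
  by rewrite linear_sum; apply: eq_bigr => l _; rewrite linearZ.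
have g0 i : (i <= 2 ^ k)%N -> Cp_fun (T w) (pre (dyadic k i)) = 0.
  rewrite -ltnS => ilt; rewrite TwE Cp_sumE.
  move/rowP: aA => /(_ (Ordinal ilt)); rewrite !mxE => aA0.
  by rewrite -[RHS]aA0; apply: eq_bigr => l _; rewrite mxE.
have gb m i : (i < 2 ^ (m + k))%N -> bend (Cp_fun (T w) \o pre) (m + k) i = 0.
  move=> ilt; rewrite TwE.
  rewrite (Cp_bend_lincomb pre (index_enum 'I_M) (fun l => a 0 l)
    (fun l => f (N + l)%N)) big1// => l _.
  by rewrite bend0 ?leq_addr// mulr0.
(* From level to level, the vanishing coefficients propagate the zeros. *)
have gd m i : (i <= 2 ^ (m + k))%N -> Cp_fun (T w) (pre (dyadic (m + k) i)) = 0.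
  elim: m i => [|m IH] i; first exact: g0.
  rewrite addSn expnS => ile; have := odd_double_half i.
  case: (odd i) => iE; rewrite -iE; last first.
    by rewrite add0n dyadic_double IH//; lia.
  have := gb m i./2; rewrite /bend /= !IH; [|lia|lia].
  by rewrite addr0 mul0r subr0; apply; lia.
have g00 : T w = 0.
  apply: CpP => x; apply: (_ : Cp_fun (T w) x = 0).
  have clK : closed (phi @` [set x | Cp_fun (T w) x = 0]).
    by apply: closed_image; apply: closed_eq0; exact: cts_fun.
  suff /clK[y /= y0 yx] : closure (phi @` [set x | Cp_fun (T w) x = 0]) (phi x).
    by rewrite -y0; apply: (FT w).1.
  have inK m i : (i <= 2 ^ (m + k))%N ->
      (phi @` [set x | Cp_fun (T w) x = 0]) (dyadic (m + k) i).
    move=> ile; exists (pre (dyadic (m + k) i)); first exact: gd.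
    exact/preK/dyadic01.
  have [p1|p1] := ltP (phi x) 1; last first.
    apply: subset_closure; have -> : phi x = dyadic (0 + k) (2 ^ k).
      rewrite /dyadic natrX mulfV ?expf_neq0//.
      by have := phi01 x; lra.
    exact: inK.
  move=> B /nbhs_ballP[e /= e0 eB].
  have [m me] := half_pow_small e0.
  have [|i [ilt]] := @dyadic_approx (m + k) (phi x).
    by rewrite p1 andbT; have /andP[] := phi01 x.
  rewrite dyadicS => /andP[ix xi].
  exists (dyadic (m + k) i); split; first by apply: inK; exact: ltnW.
  apply: eB; rewrite /ball /=.
  have : (2 : R) ^- (m + k) <= (2 : R) ^- m.
    by rewrite lef_pV2 ?posrE ?exprn_gt0// ler_weXn2l ?leq_addr//; lra.
  by rewrite ger0_norm ?subr_ge0//; lra.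
have w0 : w = 0 by rewrite -(TK w) -(TK 0) g00 linear0.
move/negP: an0; apply; apply/eqP/rowP => l; rewrite mxE.
have := congr1 (fun c : c0p R => c (N + l)%N : R) w0.
rewrite [RHS](_ : _ = 0)// => <-.
rewrite /w (big_morph (fun c : c0p R => c (N + l)%N : R)
  (id1 := 0) (op1 := +%R))//.
rewrite (bigD1 l)//= big1 ?addr0 => [|l' /negbTE ll'].
  by rewrite [RHS](_ : _ = a 0 l * (N + l == N + l)%:R)// eqxx mulr1.
rewrite [LHS](_ : _ = a 0 l' * (N + l == N + l')%:R)// eqn_add2l.
by rewrite eq_sym -val_eqE /= in ll'; rewrite ll' mulr0.
Qed.

End NoCopy.

(** * The equivalence *)

Theorem theorem3 (R : realType) (X : topologicalType)
    (hX : hausdorff_space X) (cX : compact [set: X])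
    (iX : infinite_set [set: X]) :
  scattered X <->
  (forall F : set (Cp R X),
     closed F -> vector_subspace F -> ~ finite_dimensional F ->
     exists G : set (Cp R X),
       [/\ G `<=` F, copy_of (c0p R) G & complemented G]).
Proof.
split=> [sX F|copies A [a Aa]]; first exact: scattered_complemented_copy.
apply: contrapT => nA.
have A0 : isolated A = set0.
  by rewrite -subset0 => x Ax; apply: nA; exists x.
have [phi [phic phi01 phiT]] :=
  @onto_unit_interval R X hX cX A (ex_intro _ a Aa) A0.
have [t|pre preK] := @choice R X (fun t x => 0 <= t <= 1 -> phi x = t).
  have [/phiT[x xt]|nt] := boolP (0 <= t <= 1); first by exists x.
  by exists a.
have [G [GF cG _]] := copies _ (@bent_functions_closed R X phi pre)
  (bent_functions_subspace phi pre) (bent_functions_infinite phic preK).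
exact: (no_copy cX phic phi01 preK GF cG).
Qed.
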